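(* There exists a universal constant $C>0$ such that the following holds. Let $n\ge1$, let $P_1,\dots,P_n$ be probability distributions on a common measurable space, let $M=M(P_1,\dots,P_n)\in\mathbb{R}^{n\times n}$ be the channel overlap matrix they generate, with eigenvalues $1=\lambda_1(M)\ge\lambda_2(M)\ge\cdots\ge\lambda_n(M)\ge0$, and let $\mathsf{T}:=\sum_{i=2}^n\lambda_i(M)$. For $1\le k\le n$, let $\mathbb{P}_{n,k}$ and $\mathbb{Q}_{n,k}$ denote the $k$-dimensional marginals (laws of the first $k$ coordinates) of $$\mathbb{P}_n=\mathbb{E}_{\pi\sim\mathrm{Unif}(S_n)}\left[\bigotimes_{i=1}^n P_{\pi(i)}\right]\quad\text{and}\quad \mathbb{Q}_n=\left(\frac1n\sum_{i=1}^n P_i\right)^{\otimes n},$$ respectively. Then $$\chi^2(\mathbb{P}_{n,k}\|\mathbb{Q}_{n,k})\le\frac{Ck^2}{n^2}\,\min\{\mathsf{T}^2,\mathsf{T}\}\qquad\text{whenever}\quad k\le\frac{n}{C\sqrt{\min\{\mathsf{T}^2,\mathsf{T}\}}}$$ (the condition on $k$ being void if $\mathsf{T}=0$). In particular, along any sequence of such instances $(n,k,P_1,\dots,P_n)$ with $k=o(n/\sqrt{\mathsf{T}})$, i.e. $k\sqrt{\mathsf{T}}/n\to0$, one has $\chi^2(\mathbb{P}_{n,k}\|\mathbb{Q}_{n,k})=o(1)$.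
   Context: $\mathrm{Unif}(S_n)$ is the uniform distribution on the symmetric group $S_n$, so $\mathbb{P}_n=\frac{1}{n!}\sum_{\pi\in S_n}P_{\pi(1)}\otimes\cdots\otimes P_{\pi(n)}$; this law is exchangeable, so all its $k$-dimensional marginals coincide. The channel overlap matrix $M=M(P_1,\dots,P_n)$ has entries $$M_{ij}=\frac1n\int\frac{\mathrm{d}P_i\,\mathrm{d}P_j}{\mathrm{d}\overline P}=\frac1n\int\frac{\mathrm{d}P_i}{\mathrm{d}\overline P}\frac{\mathrm{d}P_j}{\mathrm{d}\overline P}\,\mathrm{d}\overline P,\qquad \overline P=\frac1n\sum_{i=1}^n P_i.$$ It is symmetric positive semidefinite and doubly stochastic. The chi-squared divergence is $\chi^2(P\|Q)=\int\left(\frac{\mathrm{d}P}{\mathrm{d}Q}\right)^2\mathrm{d}Q-1$ for $P\ll Q$ (and $+\infty$ otherwise). ''Universal constant'' means independent of $n$, $k$, the measurable space and $P_1,\dots,P_n$. *)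

(* Defs.v *)
From HB Require Import structures.
From mathcomp Require Import all_boot all_order all_algebra perm.
From mathcomp Require Import all_classical all_reals all_analysis.

Set Implicit Arguments.
Unset Strict Implicit.
Unset Printing Implicit Defensive.

Import Order.TTheory GRing.Theory Num.Theory.
Import numFieldNormedType.Exports.

Local Open Scope classical_set_scope.
Local Open Scope ring_scope.
Local Open Scope ereal_scope.
Local Open Scope charge_scope.

Section uniform_mixture.
Context d (T : measurableType d) (R : realType).
Variables (I : finType) (P : I -> probability T R).

(* The positivity argument only serves to make the mixture a probability. *)
Definition unif_mixture of (0 < #|I|)%N := fun A : set T =>
  (#|I|%:R^-1)%:E * \sum_(i : I) P i A.

Variable I_gt0 : (0 < #|I|)%N.
Local Notation mix := (unif_mixture I_gt0).

Let mix0 : mix set0 = 0.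
Proof. by rewrite /unif_mixture big1 ?mule0. Qed.

Let mix_ge0 A : 0 <= mix A.
Proof. by rewrite /unif_mixture mule_ge0 ?lee_fin ?invr_ge0// sume_ge0. Qed.

Let mix_sigma_additive : semi_sigma_additive mix.
Proof.
move=> F mF tF mUF; rewrite /unif_mixture.
rewrite [X in X @ \oo --> _](_ : _ = fun n => (#|I|%:R^-1)%:E *
    \sum_(i : I) \sum_(0 <= j < n) P i (F j)); last first.
  apply/funext => n; rewrite exchange_big/= ge0_sume_distrr//.
  by move=> j _; exact: sume_ge0.
apply: cvgeZl => //.
apply: cvg_nnesum => [i _|i _]; last exact: measure_semi_sigma_additive.
by apply: nearW => n; exact: sume_ge0.
Qed.

HB.instance Definition _ := isMeasure.Build _ _ _ mix
  mix0 mix_ge0 mix_sigma_additive.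

Let mix_setT : mix setT = 1.
Proof.
rewrite /unif_mixture (eq_bigr (fun=> 1)) => [|i _]; last first.
  exact: probability_setT.
rewrite sumEFin -EFinM sumr_const mulVf//.
by rewrite pnatr_eq0 -lt0n.
Qed.

HB.instance Definition _ := Measure_isProbability.Build _ _ _ mix mix_setT.

End uniform_mixture.

Section tuple_cons.
Context d (T : measurableType d).

Definition tuple_cons n (x : T * n.-tuple T) : n.+1.-tuple T :=
  [the n.+1.-tuple T of x.1 :: x.2].

Let measurable_tuple_cons n : measurable_fun setT (@tuple_cons n).
Proof. exact: measurable_cons. Qed.

HB.instance Definition _ n := isMeasurableFun.Build _ _ _ _ (@tuple_cons n)
  (@measurable_tuple_cons n).

End tuple_cons.

Section product_probability.
Context d (T : measurableType d) (R : realType).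

Fixpoint prod_probability n :
    ('I_n -> probability T R) -> probability (n.-tuple T) R :=
  if n is n'.+1 then fun P =>
    distribution (P ord0 \x prod_probability (fun i : 'I_n' => P (lift ord0 i)))
      (@tuple_cons _ T n')
  else fun=> \d_[tuple].

Lemma prod_probability_box n (P : 'I_n -> probability T R)
    (A : 'I_n -> set T) : (forall i, measurable (A i)) ->
  prod_probability P [set x | forall i, A i (tnth x i)] =
  \prod_(i < n) P i (A i).
Proof.
elim: n P A => [|n IH] P A mA.
  by rewrite big_ord0 /= /dirac indicE mem_set// => -[].
rewrite big_ord_recl /= /distribution /pushforward.
rewrite [X in (_ \x _) X](_ : _ = A ord0 `*`
    [set x | forall i, A (lift ord0 i) (tnth x i)]).
  rewrite product_measure1E; [|exact: mA|].
    by congr (_ * _); exact: IH.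
  have -> : [set x : n.-tuple T | forall i : 'I_n, A (lift ord0 i) (tnth x i)] =
      \bigcap_(i in [set: 'I_n])
        ((fun x : n.-tuple T => tnth x i) @^-1` A (lift ord0 i)).
    by apply/seteqP; split => x /= h i *; exact: h.
  apply: fin_bigcap_measurable => [|i _]; first exact: finite_finset.
  by rewrite -[X in measurable X]setTI; exact: measurable_tnth.
apply/seteqP; split => -[x t] /=.
  move=> h; split; first exact: (h ord0).
  by move=> i; have := h (lift ord0 i); rewrite tnthS.
move=> [h0 h1] i; case: (unliftP ord0 i) => [j ->|->//].
by rewrite tnthS.
Qed.

End product_probability.

Section first_coords.
Context d (T : measurableType d) (n k : nat).
Variable (kn : (k <= n)%N).

Definition first_coords (x : n.-tuple T) : k.-tuple T :=
  [tuple tnth x (widen_ord kn i) | i < k].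

Let measurable_first_coords : measurable_fun setT first_coords.
Proof.
apply/measurable_fun_tnthP => i.
rewrite (_ : _ \o _ = fun x => tnth x (widen_ord kn i)).
  exact: measurable_tnth.
by apply/funext => x /=; rewrite tnth_mktuple.
Qed.

HB.instance Definition _ := isMeasurableFun.Build _ _ _ _ first_coords
  measurable_first_coords.

End first_coords.

Definition marginal d (T : measurableType d) (R : realType) (n k : nat)
    (kn : (k <= n)%N) (P : probability (n.-tuple T) R) :
  probability (k.-tuple T) R := distribution P (first_coords kn).

Section chi_squared.
Context d (T : measurableType d) (R : realType).

Definition density (P Q : probability T R) : T -> \bar R :=
  'd (charge_of_finite_measure P) '/d Q.

Definition chi2 (P Q : probability T R) : \bar R :=
  if `[< P `<< Q >] then \int[Q]_x (density P Q x ^+ 2) - 1 else +oo.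

End chi_squared.

Section permutation_mixture.
Context d (T : measurableType d) (R : realType) (n : nat).
Variables (n_gt0 : (0 < n)%N) (P : 'I_n -> probability T R).

Fact card_ord_gt0 : (0 < #|'I_n|)%N. Proof. by rewrite card_ord. Qed.

Fact card_perm_gt0 : (0 < #|{perm 'I_n}|)%N.
Proof. by apply/card_gt0P; exists 1%g. Qed.

Definition mean_probability : probability T R := unif_mixture P card_ord_gt0.

Definition permutation_mixture : probability (n.-tuple T) R :=
  unif_mixture (fun s : {perm 'I_n} => prod_probability (fun i => P (s i)))
    card_perm_gt0.

Definition iid_mean : probability (n.-tuple T) R :=
  prod_probability (fun=> mean_probability).

(* Each P i is dominated by the mean, with density at most n almost everywhere,
   so the integrals are finite and fine loses nothing. *)
Definition channel_overlap : 'M[R]_n :=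
  \matrix_(i, j) (n%:R^-1 * fine (\int[mean_probability]_x
    (density (P i) mean_probability x * density (P j) mean_probability x)))%R.

End permutation_mixture.

(* Eigenvalues are listed with multiplicity, in nonincreasing order. *)
Definition eigenvalues_of (R : realType) n (M : 'M[R]_n) (lam : seq R) : Prop :=
  sorted >=%R lam /\ char_poly M = (\prod_(x <- lam) ('X - x%:P))%R.

(* Main.v *)
Require Import Defs.
From HB Require Import structures.
From mathcomp Require Import all_boot all_order all_algebra perm.
From mathcomp Require Import separable cyclic cyclotomic sesquilinear spectral.
From mathcomp Require Import complex ring lra zify.
From mathcomp Require Import all_classical all_reals all_analysis.
From mathcomp Require Import measurable_realfun.

(** The integral of the squared density of the marginal is an explicit sum.
    Each P i has a density q i with respect to the mean Q of the P i, and the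
    marginal of the permutation mixture has with respect to the k-fold power
    of Q the density E_s prod_(i < k) q (s i) (x i), for a uniform permutation
    s.  Squaring and integrating, one plus the chi-squared divergence is
      E_(s, t) prod_(i < k) n M (s i) (t i)
    with s, t independent and M the channel overlap matrix.  Writing n M = 1 +
    n K, where K = M - 1 / n is the centered overlap matrix, and expanding the
    product, one gets a sum over l of binomial (k, l) n ^ l times E_(s, t)
    prod_(i < l) K (s i) (t i) (prod_add1_expansion).  The term l = 0 is 1.  The
    term l = 1 vanishes because the rows of K sum to zero.

    With T the trace of K and tau = min (T, sqrt T), the main estimate
    (overlap_sum_bound) says that the sum over s and t of the product of l
    factors K is at most ((n - l)!)^2 l! (128 tau) ^ l.  The term of degree l is
    then at most q ^ l with q = 512 tau k / n, and for q <= 1 / 2 their sum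
    from l = 2 on is at most 2 q ^ 2, which is the claim since tau ^ 2 = min
    (T ^ 2, T).

    Two arguments share the range of l.  The first one (overlap_sum_le)
    diagonalises K.  The overlap sum becomes a sum, over all maps m from the l
    positions to the eigenvectors v, of the product of the eigenvalues times the
    square of sum_s prod_(i < l) v (m i) (s i).  This last sum is (n - l)! times
    a mixed coefficient of prod_j (1 + sum_i z_i v (m i) j), and is estimated by
    the maximum of the product over unimodular z_i (partial_perm_sum_le); since
    the eigenvectors for nonzero eigenvalues are orthogonal to constants,
    |prod (1 + w j)| is at most exp (||w||^2 / 2) and not exponential in n.  Summing over m leaves l! times
    the complete homogeneous symmetric polynomial of the eigenvalues, which is
    at most prod_(i < l) (T + i min (1, T)) because the eigenvalues lie in
    [0, 1] and have sum T.  This suffices when T <= 1 or l >= sqrt T.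

    For l <= sqrt T the second argument resamples one position
    (perm_sum_resample): given the values of s at l positions, its value at
    another one is uniform among the rest, so a factor K there is replaced by
    minus the sum of its values at the l positions already used.  Being positive
    semidefinite, K turns this identity into an inequality between overlap sums
    (marked_sum_le), in which pairs of positions merge at the cost of
    sum (K a b)^2 <= T.  Hence T per pair, that is sqrt T per position
    (small_overlap_sum_le).

    Finally the eigenvalues of M are at most 1, and 1 is one of them, so the sum
    of the others is the trace of K (sum_nontop_eigenvalues). *)

Set Implicit Arguments.
Unset Strict Implicit.
Unset Printing Implicit Defensive.

Import Order.TTheory GRing.Theory Num.Theory.
Import numFieldNormedType.Exports.

Local Open Scope ring_scope.

(** * Powers, factorials and elementary inequalities *)

(** Bernoulli's inequality bounds (n / (n + 1)) ^ m below by 1 / 2 as soon as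
    2 m <= n + 1, and n is a sum of two such m. *)
Lemma expnS_le4 n : (n.+1 ^ n <= 4 * n ^ n)%N.
Proof.
have bern m : (m <= n)%N -> ((n.+1 - m) * n.+1 ^ m <= n ^ m * n.+1)%N.
  elim: m => [|m IH] mn; first by rewrite subn0 !expn0 mul1n muln1.
  rewrite !expnS.
  have := IH (ltnW mn); move: (n ^ m)%N (n.+1 ^ m)%N => a b; nia.
have half m : (m.*2 <= n.+1)%N -> (n.+1 ^ m <= 2 * n ^ m)%N.
  case: n bern => [|k] bern mn; first by case: m mn => [|[]].
  have := bern m; move: (_ ^ m)%N (_ ^ m)%N => a b; nia.
have nE : (n./2 + uphalf n)%N = n by rewrite -[RHS]odd_double_half uphalf_half; lia.
have h1 : (n./2.*2 <= n.+1)%N by rewrite -[in leqRHS](odd_double_half n); lia.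
have h2 : ((uphalf n).*2 <= n.+1)%N by rewrite uphalf_half -[in leqRHS](odd_double_half n); lia.
have := leq_mul (half _ h1) (half _ h2).
by rewrite mulnACA -!expnD nE.
Qed.

(** This is (1 + l / n) ^ n <= 4 ^ l, from 1 + l / n <= (1 + 1 / n) ^ l. *)
Lemma expnD_le n l : ((n + l) ^ n <= 4 ^ l * n ^ n)%N.
Proof.
case: n => [|n]; first by rewrite muln1 expn_gt0.
set N := n.+1.
have bern : ((N + l) * N ^ l <= N * N.+1 ^ l)%N.
  elim: l => [|l IH]; first by rewrite addn0.
  rewrite !expnS; move: IH; move: (N ^ l)%N (N.+1 ^ l)%N => a b; nia.
have : (((N + l) * N ^ l) ^ N <= (N * N.+1 ^ l) ^ N)%N by rewrite leq_exp2r.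
rewrite !expnMn -!expnM [(l * N)%N]mulnC !expnM => h.
have h2 : ((N.+1 ^ N) ^ l <= (4 * N ^ N) ^ l)%N by case: (l) => // k; rewrite leq_exp2r// expnS_le4.
have Npos : (0 < (N ^ N) ^ l)%N by rewrite expn_gt0 expn_gt0.
rewrite -(leq_pmul2r Npos) (leq_trans h)//.
by rewrite mulnAC -expnMn mulnC leq_mul2r h2 orbT.
Qed.

Lemma expnn_le k : (k ^ k <= 4 ^ k * k`!)%N.
Proof.
elim: k => [//|k IH]; rewrite factS [(k.+1 ^ _)%N]expnS [(4 ^ _)%N]expnS.
by have := expnS_le4 k; move: IH; move: (k ^ k)%N (k.+1 ^ k)%N (4 ^ k)%N (k`!) => a b c d; nia.
Qed.

Lemma ffact_ratio_le n k l : (k <= n)%N -> (k ^_ l * n ^ l <= k ^ l * n ^_ l)%N.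
Proof.
move=> kn; elim: l => [//|l IH]; rewrite !ffactnSr !expnSr.
have h : ((k - l) * n <= k * (n - l))%N by rewrite mulnBl mulnBr leq_sub2l// [(k * l)%N]mulnC leq_mul2l kn orbT.
rewrite mulnACA [leqRHS]mulnACA; exact: leq_mul.
Qed.

(** The ratio n ^_ l / n ^ l increases with n, so that its least value is the
    one at n = l. *)
Lemma expn_le_ffact n l : (l <= n)%N -> (n ^ l <= 4 ^ l * n ^_ l)%N.
Proof.
move=> ln; have := ffact_ratio_le l ln; rewrite ffactnn => h.
rewrite -(leq_pmul2l (fact_gt0 l)) (leq_trans h)// mulnA [(l`! * _)%N]mulnC.
by rewrite leq_mul2r expnn_le orbT.
Qed.

Lemma geometric_sum_le2 (R : realFieldType) (q : R) m :
  0 <= q <= 2^-1 -> \sum_(i < m) q ^+ i <= 2.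
Proof.
move=> /andP[q0 q1].
have S0 : 0 <= \sum_(i < m) q ^+ i by apply: sumr_ge0 => i _; exact: exprn_ge0.
have := subrX1 q m; have := exprn_ge0 m q0.
move: (\sum_(i < m) q ^+ i) (q ^+ m) S0 => S x S0 x0 e.
nra.
Qed.

Lemma sqr_sum_le (R : realFieldType) (I : finType) (x : I -> R) :
  (\sum_i x i) ^+ 2 <= #|I|%:R * \sum_i x i ^+ 2.
Proof.
have : 0 <= \sum_i \sum_j (x i - x j) ^+ 2.
  by do 2 apply: sumr_ge0 => ? _; exact: sqr_ge0.
rewrite (eq_bigr (fun i => #|I|%:R * x i ^+ 2 - 2 * x i * (\sum_j x j) + \sum_j x j ^+ 2)).
  rewrite big_split sumrB/= -mulr_sumr -mulr_suml -mulr_sumr sumr_const -mulr_natl; lra.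
move=> i _; rewrite mulr_natl -sumr_const mulr_sumr -sumrB -big_split/=.
by apply: eq_bigr => j _; ring.
Qed.

(** * Sums over permutations of products of vector entries *)

Lemma closed_prim_root_exists (C : numClosedFieldType) n :
  (0 < n)%N -> exists z : C, n.-primitive_root z.
Proof.
move=> n_gt0; have [r] := closed_field_poly_normal ('X^n - 1 : {poly C}).
rewrite (monicP _) ?monicXnsubC// scale1r => rE.
have sep : separable_poly (\prod_(z <- r) ('X - z%:P)).
  by rewrite -rE separable_Xn_sub_1// pnatr_eq0 -lt0n.
have all_r : all n.-unity_root r.
  by apply/allP => z; rewrite -root_prod_XsubC -rE.
have le_r : (n <= size r)%N.
  by rewrite -ltnS -(size_prod_XsubC r id) -rE size_XnsubC.
have /hasP[z _ ?] : has n.-primitive_root r.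
  by apply: has_prim_root => //; rewrite -separable_prod_XsubC.
by exists z.
Qed.

Lemma norm_unity_root (C : numDomainType) n (z : C) :
  (0 < n)%N -> z ^+ n = 1 -> `|z| = 1.
Proof.
move=> n_gt0 zn1; apply/eqP; rewrite -(@pexpr_eq1 _ _ n)//.
by rewrite -normrX zn1 normr1.
Qed.

(** Cauchy's estimate without integration: the mean of p (z) / z over the N-th
    roots of unity, N larger than the degree, is the coefficient of degree
    one. *)
Lemma coef1_le_circle (C : numClosedFieldType) (p : {poly C}) (K : C) :
  (forall z, `|z| = 1 -> `|p.[z]| <= K) -> `|p`_1| <= K.
Proof.
move=> pK; pose N := (size p).+2.
have [z zP] := @closed_prim_root_exists C N isT.
have zN := prim_expr_order zP.
have nz : `|z| = 1 by exact: (norm_unity_root _ zN).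
have z0 : z != 0 by rewrite -normr_eq0 nz oner_eq0.
have key : \sum_(k < N) p.[z ^+ k] * (z ^+ k)^-1 = p`_1 *+ N.
  rewrite (eq_bigr (fun k : 'I_N =>
     \sum_(i < N) p`_i * (z ^+ i / z) ^+ k)); last first.
    move=> k _; rewrite (@horner_coef_wide _ N) ?mulr_suml//; last first.
      by rewrite /N; do 2 apply: leqW.
    apply: eq_bigr => i _; rewrite -mulrA; congr (_ * _).
    by rewrite expr_div_n -!exprM mulnC.
  rewrite exchange_big/=.
  pose j1 : 'I_N := Ordinal (isT : (1 < N)%N).
  rewrite (bigD1 j1)//= [X in _ + X]big1 ?addr0.
    rewrite (eq_bigr (fun=> p`_1)) ?sumr_const ?card_ord// => k _.
    by rewrite expr1 divff// expr1n mulr1.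
  move=> i i1; rewrite -mulr_sumr.
  have : (z ^+ i / z) ^+ N - 1 = 0.
    by rewrite expr_div_n -exprM mulnC exprM zN expr1n divr1 subrr.
  rewrite subrX1 => /eqP; rewrite mulf_eq0 subr_eq0 => /orP[|/eqP->]; last by rewrite mulr0.
  rewrite -(inj_eq (mulIf z0)) divfK// mul1r -[X in _ == X]expr1 (eq_prim_root_expr zP) => /eqP.
  rewrite !modn_small// => i1'; case/negP: i1; exact/eqP/val_inj.
have : `|p`_1 *+ N| <= K *+ N.
  rewrite -key (le_trans (ler_norm_sum _ _ _))//.
  rewrite -[in leRHS](card_ord N) -sumr_const; apply: ler_sum => k _.
  by rewrite normrM normfV normrX nz expr1n invr1 mulr1 pK// normrX nz expr1n.
by rewrite normrMn ler_pMn2r.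
Qed.

Lemma coef1_prod_affine (C : comRingType) (I : finType) (P : pred I) (a b : I -> C) :
  (\prod_(i | P i) ((a i)%:P + (b i)%:P * 'X))`_1 =
  \sum_(i | P i) b i * \prod_(j | P j && (j != i)) a j.
Proof.
have aux (s : seq I) : uniq s ->
   ((\prod_(i <- s | P i) ((a i)%:P + (b i)%:P * 'X))`_1 =
   \sum_(i <- s | P i) b i * \prod_(j <- s | P j && (j != i)) a j) /\
   ((\prod_(i <- s | P i) ((a i)%:P + (b i)%:P * 'X))`_0 = \prod_(i <- s | P i) a i).
  elim: s => [|x s IH] /=; first by rewrite !big_nil !coefC.
  move=> /andP[xs us]; have [IH1 IH0] := IH us.
  rewrite !big_cons; case: ifP => Px; last first.
    split=> //; rewrite IH1; apply: eq_bigr => i Pi.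
    by rewrite big_cons Px.
  split; last first.
    by rewrite mulrDl coefD -mulrA !coefCM coefXM/= mulr0 addr0 IH0.
  rewrite mulrDl coefD -mulrA !coefCM coefXM/= IH0 IH1 eqxx ?andbF/= addrC.
  congr (_ + _).
    congr (_ * _); rewrite big_seq_cond [RHS]big_seq_cond.
    apply: eq_bigl => i; case: (boolP (i \in s)) => //= is_.
    have ix : i != x by apply: contraNneq xs => <-.
    by rewrite ix andbT.
  rewrite mulr_sumr big_seq_cond [RHS]big_seq_cond; apply: eq_bigr => i /andP[is_ Pi].
  rewrite big_cons Px /=; case: eqP => [xi|_]; first by rewrite xi is_ in xs.
  by rewrite /= mulrCA.
have [] := aux (index_enum I) (index_enum_uniq I).
by [].
Qed.

Section permutation_sums.
Variables (C : numClosedFieldType) (n : nat).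
Implicit Types (u : 'I_n -> 'I_n -> C) (w : 'I_n -> C).

(** An interpolation in l: at l = 0 it is n! times the product of the 1 + w j,
    and at w = 0 it is the sum over permutations of the products of the l
    entries u i (s i). *)
Definition partial_perm_sum l u w : C := \sum_(s : {perm 'I_n})
  (\prod_(i < n | (i < l)%N) u i (s i)) * \prod_(i < n | (l <= i)%N) (1 + w (s i)).

(** Passing from l to l + 1 is a directional derivative: by symmetry between
    the positions i >= l, the coefficient of degree one in t of the sum at
    w + t u l is n - l times the sum for l + 1 at w.  Cauchy's estimate bounds
    each of these l coefficients by a maximum over a unimodular z i. *)
Lemma partial_perm_sum_le l u w (K : C) : (l <= n)%N ->
  (forall z : 'I_n -> C, (forall i, `|z i| = 1) ->
     `|\prod_j (1 + (w j + \sum_(i < n | (i < l)%N) z i * u i j))| <= K) ->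
  `|partial_perm_sum l u w| *+ n ^_ l <= K *+ n`!.
Proof.
elim: l w => [|l IH] w ln wK.
  rewrite ffactn0 mulr1n; apply: (le_trans (ler_norm_sum _ _ _)).
  rewrite -card_Sn -sumr_const.
  apply: ler_sum => s _; rewrite big_pred0// mul1r.
  have := wK (fun=> 1) (fun=> normr1 _); rewrite (reindex_inj (@perm_inj _ s)).
  by under eq_bigr do rewrite big_pred0// addr0.
pose l' := Ordinal ln.
(* The sum for l, as a polynomial in the coefficient of the vector u l. *)
pose p : {poly C} := \sum_(s : {perm 'I_n})
  (\prod_(i < n | (i < l)%N) u i (s i))%:P * \prod_(i < n | (l <= i)%N) ((1 + w (s i))%:P + (u l' (s i))%:P * 'X).
have p1 : p`_1 = partial_perm_sum l.+1 u w *+ (n - l).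
  rewrite /p coef_sum.
  under eq_bigr do rewrite coefCM coef1_prod_affine mulr_sumr.
  rewrite exchange_big/= -sumr_const_nat big_geq_mkord/=.
  apply: eq_bigr => i li; rewrite [RHS](reindex_inj (mulgI (tperm l' i))).
  apply: eq_bigr => s _ /=.
  under [in RHS]eq_bigr do rewrite permM.
  under [X in _ = _ * X]eq_bigr do rewrite permM.
  rewrite [X in _ = X * _](bigD1 l')//= tpermL mulrA; congr (_ * _).
    rewrite mulrC; congr (_ * _).
    apply: eq_big => [j|j jl]; first by rewrite ltnS ltn_neqAle andbC.
    by rewrite tpermD//; apply: contraTneq jl => <-//; rewrite -leqNgt.
  rewrite [LHS](reindex_inj (@perm_inj _ (tperm l' i))).
  apply: eq_bigl => j; case: tpermP => [->|->|/eqP jl /eqP ji].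
  - by rewrite eqxx andbF ltnn.
  - by rewrite leqnn/= ltn_neqAle li andbT -val_eqE.
  - by rewrite ji andbT ltn_neqAle eq_sym -(inj_eq val_inj)/= in jl *; rewrite jl.
have nl0 : (0 < n - l)%N by rewrite subn_gt0.
rewrite ffactnSr mulnC mulrnA -normrMn -p1.
have [n0|n0] := posnP (n ^_ l); first by rewrite n0 mulr0n mulrn_wge0// (le_trans _ (wK (fun=> 1) _))// => i; rewrite normr1.
suff : `|p`_1| <= K *+ n`! / (n ^_ l)%:R.
  by rewrite ler_pdivlMr ?ltr0n// mulr_natr.
apply: coef1_le_circle => z z1; rewrite ler_pdivlMr ?ltr0n// mulr_natr.
have -> : p.[z] = partial_perm_sum l u (fun j => w j + z * u l' j).
  rewrite /p horner_sum; apply: eq_bigr => s _; rewrite hornerM hornerC horner_prod.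
  congr (_ * _); apply: eq_bigr => i _; by rewrite !hornerE [z * _]mulrC.
apply: IH => [|y y1]; first exact: ltnW.
have := wK (fun i => if i == l' then z else y i); rewrite (eq_bigr (fun j =>
   1 + (w j + z * u l' j + \sum_(i < n | (i < l)%N) y i * u i j))).
  by apply=> i; case: eqP.
move=> j _; rewrite (bigD1 l')//= eqxx -[in RHS]addrA; congr (1 + (_ + (_ + _))).
apply: eq_big => [i|i /andP[_ /negPf->]//]; rewrite ltnS [RHS]ltn_neqAle andbC; congr andb.
Qed.

End permutation_sums.

(** The vectors having sum zero, so does every combination w of them; hence
    the sum of the |1 + w j|^2 is n + ||w||^2, and the arithmetic-geometric
    inequality gives prod |1 + w j|^2 <= (1 + ||w||^2 / n) ^ n <= 4 ^ l.  The
    vanishing of the linear term is what makes this bound independent of n. *)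
Section perm_sum_bound.
Variables (C : numClosedFieldType) (n l : nat) (u : 'I_n -> 'I_n -> C).
Hypothesis ln : (l <= n)%N.
Hypothesis u0 : forall i : 'I_n, (i < l)%N -> \sum_j u i j = 0.
Hypothesis ule : forall z : 'I_n -> C, (forall i, `|z i| = 1) ->
  \sum_j `|\sum_(i < n | (i < l)%N) z i * u i j| ^+ 2 <= l%:R.

Lemma perm_sum_le :
  `|\sum_(s : {perm 'I_n}) \prod_(i < n | (i < l)%N) u i (s i)| ^+ 2 <=
  ((n - l)`! ^ 2 * 4 ^ l)%:R.
Proof.
have := @partial_perm_sum_le C n l u (fun=> 0) (2 ^ l)%:R ln.
set S := partial_perm_sum l u _; have -> : S = \sum_(s : {perm 'I_n}) \prod_(i < n | (i < l)%N) u i (s i).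
  by apply: eq_bigr => s _; rewrite [X in _ * X]big1 ?mulr1// => i _; rewrite addr0.
move=> {S} H; have {}H : `|\sum_(s : {perm 'I_n}) \prod_(i < n | (i < l)%N) u i (s i)| <= ((n - l)`! * 2 ^ l)%:R.
  have nl0 : (0 < n ^_ l)%N by rewrite ffact_gt0.
  have fE := ffact_fact ln.
  rewrite -(ler_pMn2r nl0) (le_trans (H _))//; last first.
    rewrite -!mulrnA ler_nat -fE leq_eqVlt; apply/orP; left; apply/eqP; ring.
  move=> z z1; under eq_bigr do rewrite add0r.
  set w := fun j => \sum_(i < n | (i < l)%N) z i * u i j.
  have w0 : \sum_j w j = 0.
    rewrite exchange_big/= big1// => i il; by rewrite -mulr_sumr u0// mulr0.
  rewrite -(@ler_pXn2r _ 2)// ?nnegrE// normr_prod -prodrXl.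
  have [n0|n_gt0] := posnP n.
    rewrite big1 => [|i]; last by have : (i < 0)%N by rewrite -[X in (_ < X)%N]n0 ltn_ord.
    by rewrite -natrX ler1n expn_gt0 expn_gt0.
  have nD0 : n%:R != 0 :> C by rewrite pnatr_eq0 -lt0n.
  have sqE j : `|1 + w j| ^+ 2 = 1 + (w j + (w j)^*) + `|w j| ^+ 2.
    by rewrite !normCK rmorphD/= rmorph1; ring.
  have := @leif_AGM C _ [set: 'I_n] (fun j => `|1 + w j| ^+ 2).
  rewrite cardsT card_ord => /(_ (fun j _ => exprn_ge0 2 (normr_ge0 _))) [].
  under eq_bigl do rewrite finset.in_setT.
  under [in leRHS]eq_bigl do rewrite finset.in_setT.
  move=> + _ => /le_trans; apply.
  have sumE : \sum_j `|1 + w j| ^+ 2 = n%:R + \sum_j `|w j| ^+ 2.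
    under eq_bigr do rewrite sqE.
    by rewrite !big_split/= w0 -rmorph_sum/= w0 rmorph0 !addr0 sumr_const card_ord.
  have s0 : 0 <= (\sum_j `|1 + w j| ^+ 2) / n%:R.
    by apply: divr_ge0 => //; apply: sumr_ge0 => j _; exact: exprn_ge0.
  have s1 : (\sum_j `|1 + w j| ^+ 2) / n%:R <= (n + l)%:R / n%:R.
    rewrite ler_pM2r ?invr_gt0 ?ltr0n// sumE natrD lerD2l; exact: ule.
  apply: (@le_trans _ _ (((n + l)%:R / n%:R) ^+ n)).
    by rewrite lerXn2r// nnegrE// (le_trans s0 s1).
  rewrite expr_div_n ler_pdivrMr ?exprn_gt0 ?ltr0n//.
  by rewrite -!natrX -natrM ler_nat -expnM (mulnC l) expnM; exact: expnD_le.
rewrite (natrM _ _ (4 ^ l)) (_ : 4 = 2 ^ 2)%N// -expnM (mulnC 2) expnM.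
by rewrite -natrM -expnMn natrX ler_pXn2r// nnegrE.
Qed.

End perm_sum_bound.

(** * Sums over index maps, weighted by multiplicities *)

Section ffun_cons.
Variables (J : finType) (l : nat).

Definition ffun_cons (p : J * {ffun 'I_l -> J}) : {ffun 'I_l.+1 -> J} :=
  [ffun i => if unlift ord0 i is Some j then p.2 j else p.1].

Lemma ffun_cons0 p : ffun_cons p ord0 = p.1.
Proof. by rewrite ffunE unlift_none. Qed.

Lemma ffun_consS p i : ffun_cons p (lift ord0 i) = p.2 i.
Proof. by rewrite ffunE liftK. Qed.

Lemma big_ffun_cons (V : nmodType) (F : {ffun 'I_l.+1 -> J} -> V) :
  \sum_m F m = \sum_c \sum_m F (ffun_cons (c, m)).
Proof.
rewrite pair_big/= (reindex ffun_cons)/=; last first.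
  exists (fun f => (f ord0, [ffun j => f (lift ord0 j)])) => [[c m] _|f _].
    rewrite ffun_cons0; congr (_, _).
    by apply/ffunP => i; rewrite ffunE ffun_consS.
  apply/ffunP => i; case: (unliftP ord0 i) => [j ->|->].
    by rewrite ffun_consS ffunE.
  by rewrite ffun_cons0.
by apply: eq_bigr => -[].
Qed.

End ffun_cons.

Section multiplicity.
Variables (J : finType).

Definition multiplicity l (m : {ffun 'I_l -> J}) (c : J) : nat :=
  \sum_(i < l) (m i == c).

Lemma sum_multiplicity l (m : {ffun 'I_l -> J}) : (\sum_c multiplicity m c = l)%N.
Proof.
rewrite exchange_big/= -[RHS]card_ord -sum1_card; apply: eq_bigr => i _.
by rewrite (bigD1 (m i))//= eqxx big1 ?addn0// => c /negPf; rewrite eq_sym => ->.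
Qed.

Lemma multiplicity_cons l c0 (m : {ffun 'I_l -> J}) c :
  multiplicity (ffun_cons (c0, m)) c = ((c0 == c) + multiplicity m c)%N.
Proof.
rewrite /multiplicity big_ord_recl ffun_cons0; congr (_ + _)%N.
by apply: eq_bigr => i _; rewrite ffun_consS.
Qed.

Lemma prod_multiplicity (A : comSemiRingType) l (m : {ffun 'I_l -> J}) (F : J -> A) :
  \prod_i F (m i) = \prod_c F c ^+ multiplicity m c.
Proof.
elim: l m => [|l IH] m.
  by rewrite big_ord0 big1// => c _; rewrite /multiplicity big_ord0.
have -> : m = ffun_cons (m ord0, [ffun j => m (lift ord0 j)]).
  apply/ffunP => i; case: (unliftP ord0 i) => [j ->|->].
    by rewrite ffun_consS ffunE.
  by rewrite ffun_cons0.
move: (m ord0) [ffun j => m (lift ord0 j)] => {m} c0 m.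
under [RHS]eq_bigr do rewrite multiplicity_cons exprD.
rewrite big_split/= -IH big_ord_recl ffun_cons0/=; congr (_ * _).
  by rewrite (bigD1 c0)//= eqxx big1 ?mulr1// => c /negPf; rewrite eq_sym => ->.
by apply: eq_bigr => i _; rewrite ffun_consS.
Qed.

(** This is l! times the complete homogeneous symmetric polynomial of degree l
    in the lam c, since a multiset with multiplicities a c has l! / prod (a c)!
    orderings. *)
Definition sym_weight (C : numDomainType) (lam : J -> C) l :=
  \sum_(m : {ffun 'I_l -> J}) (\prod_i lam (m i)) * (\prod_c (multiplicity m c)`!)%:R.

(** Appending the index c to m multiplies the weight of m by
    lam c (multiplicity m c + 1); summed over c this is at most
    sum lam + l b. *)
Lemma sym_weight_le (C : numDomainType) (lam : J -> C) (b : C) l :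
  (forall c, 0 <= lam c) -> (forall c, lam c <= b) ->
  sym_weight lam l <= \prod_(i < l) (\sum_c lam c + i%:R * b).
Proof.
move=> lam0 lamb; elim: l => [|l IH].
  rewrite big_ord0 /sym_weight (eq_bigr (fun=> 1)) => [|m _].
    by rewrite sumr_const card_ffun card_ord expn0.
  by rewrite big_ord0 big1 ?mulr1// => c _; rewrite /multiplicity big_ord0.
have b0 (c : J) : 0 <= b by exact: le_trans (lam0 c) (lamb c).
have T0 : 0 <= \sum_c lam c by exact: sumr_ge0.
rewrite big_ord_recr/= mulrC; apply: (@le_trans _ _ ((\sum_c lam c + l%:R * b) * sym_weight lam l)); last first.
  have [c|J0] := pickP (mem J).
    by rewrite ler_wpM2l// addr_ge0// mulr_ge0// (b0 c).
  have /= -> : \sum_c lam c = 0 by apply: big1 => c; have := J0 c.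
  case: l IH => [|l] IH; first by rewrite !mul0r addr0 !mul0r.
  rewrite /sym_weight big1 ?mulr0; last by move=> m; have := J0 (m ord0).
  by rewrite big_ord_recl /= mul0r !addr0 mul0r mulr0.
rewrite /sym_weight big_ffun_cons/= exchange_big/= mulr_sumr; apply: ler_sum => m _.
rewrite (eq_bigr (fun c => lam c * (1 + (multiplicity m c)%:R) * ((\prod_i lam (m i)) * (\prod_c (multiplicity m c)`!)%:R))); last first.
  move=> c _; rewrite big_ord_recl ffun_cons0/=.
  rewrite (eq_bigr (fun i => lam (m i))) => [|i _]; last by rewrite ffun_consS.
  rewrite (bigD1 c)//= multiplicity_cons eqxx/= add1n factS.
  rewrite [in RHS](bigD1 c)//= (eq_bigr (fun i => (multiplicity m i)`!)); last first.
    by move=> c' /negPf; rewrite eq_sym multiplicity_cons => ->.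
  by rewrite !natrM -natr1; ring.
rewrite -mulr_suml ler_wpM2r// ?mulr_ge0 ?prodr_ge0//.
rewrite (eq_bigr (fun c => lam c + lam c * (multiplicity m c)%:R)) => [|c _]; last by ring.
rewrite big_split/= lerD2l -[l in l%:R](sum_multiplicity m) natr_sum mulr_suml.
by apply: ler_sum => c _; rewrite mulrC ler_wpM2l.
Qed.

End multiplicity.

(** * Overlap sums and the spectral bound *)

(** Expanding an overlap sum along a Gram decomposition of K exhibits it as a
    squared norm; for the centered overlap matrix it is, up to normalisation,
    the squared norm of the part of degree l of the density of the permutation
    mixture. *)
Definition overlap_sum (A : pzSemiRingType) n (K : 'I_n -> 'I_n -> A) l : A :=
  \sum_(s : {perm 'I_n}) \sum_(t : {perm 'I_n}) \prod_(i < n | (i < l)%N) K (s i) (t i).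

Section orthonormal.
Variables (C : numClosedFieldType) (n : nat) (v : 'I_n -> 'I_n -> C).
Hypothesis orth : forall c c', \sum_a v c a * (v c' a)^* = (c == c')%:R.

Lemma sum_norm_orthonormal (g : 'I_n -> C) :
  \sum_a `|\sum_c g c * v c a| ^+ 2 = \sum_c `|g c| ^+ 2.
Proof.
under eq_bigr do rewrite normCK rmorph_sum/= big_distrlr/=.
rewrite exchange_big/=; apply: eq_bigr => c _.
rewrite exchange_big/= (bigD1 c)//= [X in _ + X]big1 ?addr0 => [|c' /negPf cc'].
  rewrite (eq_bigr (fun a => g c * (g c)^* * (v c a * (v c a)^*))) => [|a _].
    by rewrite -mulr_sumr orth eqxx mulr1 normCK.
  by rewrite rmorphM/=; ring.
rewrite (eq_bigr (fun a => g c * (g c')^* * (v c a * (v c' a)^*))) => [|a _].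
  by rewrite -mulr_sumr orth eq_sym cc' mulr0.
by rewrite rmorphM/=; ring.
Qed.

(** A repeated index would let its vectors add up coherently.  Dividing each
    v (m i) by the square root of its multiplicity a c compensates for this:
    a combination with unimodular coefficients then has squared norm at most
    sum (a c)^2 / a c = l, as required by perm_sum_le.  Undoing the division
    costs the product of the a c ^ a c, comparable to the product of the
    (a c)!. *)
Lemma orthonormal_perm_sum_le l (ln : (l <= n)%N) (m : {ffun 'I_l -> 'I_n}) :
  (forall i, \sum_a v (m i) a = 0) ->
  `|\sum_(s : {perm 'I_n}) \prod_(i < l) v (m i) (s (widen_ord ln i))| ^+ 2 <=
  ((n - l)`! ^ 2 * 16 ^ l * \prod_c (multiplicity m c)`!)%:R.
Proof.
move=> v0.
pose al c := (multiplicity m c)%:R : C.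
have al_gt0 i : 0 < al (m i).
  by rewrite ltr0n /multiplicity (bigD1 i)//= eqxx.
pose x c := (sqrtC (al c))^-1.
have x_ge0 c : 0 <= x c by rewrite invr_ge0 sqrtC_ge0 ler0n.
have x2 c : x c ^+ 2 = (al c)^-1 by rewrite exprVn sqrtCK.
pose u (i : 'I_n) j := if insub (i : nat) is Some k then x (m k) * v (m k) j else 0.
have uE (k : 'I_l) j : u (widen_ord ln k) j = x (m k) * v (m k) j.
  by rewrite /u /= valK.
have := @perm_sum_le C n l u ln.
have -> : \sum_(s : {perm 'I_n}) \prod_(i < n | (i < l)%N) u i (s i) =
   \prod_i x (m i) * \sum_(s : {perm 'I_n}) \prod_(i < l) v (m i) (s (widen_ord ln i)).
  rewrite mulr_sumr; apply: eq_bigr => s _.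
  rewrite big_ord_narrow -big_split/=.
  by apply: eq_bigr => i _; rewrite uE.
set S := \sum_(s : _) _; move=> H.
have {}H : `|\prod_i x (m i) * S| ^+ 2 <= ((n - l)`! ^ 2 * 4 ^ l)%:R.
  apply: H => [i il|z z1].
    have -> : i = widen_ord ln (Ordinal il) by exact: val_inj.
    by under eq_bigr do rewrite uE; rewrite -mulr_sumr v0 mulr0.
  pose g c := \sum_(i < l | m i == c) z (widen_ord ln i) * x c.
  rewrite (eq_bigr (fun a => `|\sum_c g c * v c a| ^+ 2)) => [|a _]; last first.
    rewrite big_ord_narrow; congr (`|_| ^+ 2).
    under [RHS]eq_bigr do rewrite mulr_suml.
    rewrite (exchange_big_dep xpredT)//=; apply: eq_bigr => i _.
    rewrite (big_pred1 (m i)) ?uE ?mulrA//.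
  rewrite sum_norm_orthonormal -[l in l%:R](sum_multiplicity m) natr_sum.
  apply: ler_sum => c _.
  have gle : `|g c| <= al c * x c.
    apply: (le_trans (ler_norm_sum _ _ _)).
    rewrite (eq_bigr (fun=> x c)) => [|i _]; last first.
      by rewrite normrM z1 mul1r ger0_norm.
    rewrite /al /multiplicity natr_sum mulr_suml [leLHS]big_mkcond/=.
    by apply: ler_sum => i _; case: eqP; rewrite ?mul1r ?mul0r.
  have [c0|c0] := eqVneq (multiplicity m c) 0%N.
    move: gle; rewrite /al c0 mul0r normr_le0 => /eqP->.
    by rewrite normr0 expr0n.
  apply: (@le_trans _ _ ((al c * x c) ^+ 2)).
    by rewrite lerXn2r// ?nnegrE// mulr_ge0// ler0n.
  by rewrite exprMn x2 expr2 -mulrA divff ?mulr1// pnatr_eq0.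
have xal : \prod_i x (m i) ^+ 2 * \prod_i al (m i) = 1.
  rewrite -big_split/= big1// => i _.
  by rewrite x2 mulVf// gt_eqF.
have al0 : 0 <= \prod_i al (m i) by apply: prodr_ge0 => i _; exact: ltW.
have := ler_wpM2r al0 H.
rewrite normrM exprMn ger0_norm ?prodr_ge0// -prodrXl mulrAC xal mul1r => /le_trans; apply.
rewrite (prod_multiplicity m al).
under eq_bigr do rewrite -natrX.
rewrite -natr_prod -natrM ler_nat.
have hP : (\prod_c multiplicity m c ^ multiplicity m c <=
           4 ^ l * \prod_c (multiplicity m c)`!)%N.
  rewrite -[X in (4 ^ X)%N](sum_multiplicity m) expn_sum -big_split/=.
  by apply: leq_prod => c _; exact: expnn_le.
apply: (leq_trans (leq_mul (leqnn _) hP)).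
by rewrite !mulnA -(mulnA ((n - l)`! ^ 2)%N) -expnMn.
Qed.

Variable lam : 'I_n -> C.
Hypothesis lam0 : forall c, 0 <= lam c.
Hypothesis lamv : forall c, lam c != 0 -> \sum_a v c a = 0.

Let K a b := \sum_c lam c * v c a * (v c b)^*.

(** Expanding every factor over the eigenvectors gives a sum, over the maps m
    from positions to eigenvectors, of the product of the eigenvalues times a
    squared modulus. *)
Lemma spectral_overlap_sum_le l (b : C) : (l <= n)%N -> (forall c, lam c <= b) ->
  overlap_sum K l <= ((n - l)`! ^ 2 * 16 ^ l)%:R * \prod_(i < l) (\sum_c lam c + i%:R * b).
Proof.
move=> ln lamb.
pose S m := \sum_(s : {perm 'I_n}) \prod_(i < l) v (m i) (s (widen_ord ln i)).
have -> : overlap_sum K l = \sum_(m : {ffun 'I_l -> 'I_n}) (\prod_i lam (m i)) * `|S m| ^+ 2.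
  under [RHS]eq_bigr do rewrite normCK rmorph_sum/= big_distrlr/= mulr_sumr.
  rewrite exchange_big/=; apply: eq_bigr => s _.
  under [RHS]eq_bigr do rewrite mulr_sumr.
  rewrite exchange_big/=; apply: eq_bigr => t _.
  rewrite big_ord_narrow bigA_distr_bigA/=; apply: eq_bigr => m _.
  by rewrite rmorph_prod/= mulrA -!big_split.
apply: (@le_trans _ _ (((n - l)`! ^ 2 * 16 ^ l)%:R * sym_weight lam l)); last first.
  by rewrite ler_wpM2l// sym_weight_le.
rewrite /sym_weight mulr_sumr; apply: ler_sum => m _; rewrite [leRHS]mulrCA.
case: (pickP (fun i => lam (m i) == 0)) => [i /eqP mi|nz].
  have -> : \prod_i lam (m i) = 0 by rewrite (bigD1 i)//= mi mul0r.
  by rewrite !mul0r.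
apply: ler_wpM2l; first exact: prodr_ge0.
by rewrite -natrM; apply: orthonormal_perm_sum_le => i; apply: lamv; rewrite nz.
Qed.

End orthonormal.

(** * Spectral theory of the centered kernel *)

Local Open Scope complex_scope.

Lemma conj_mul_complexE (R : rcfType) (z w : R[i]) : Num.conj z * w =
  (complex.Re z * complex.Re w + complex.Im z * complex.Im w)%:C + 
  'i * (complex.Re z * complex.Im w - complex.Im z * complex.Re w)%:C.
Proof. by case: z w => [a b] [c d]; simpc; congr (_ +i* _); ring. Qed.

Section hermitian_form.
Variables (R : rcfType) (n : nat) (K : 'I_n -> 'I_n -> R).
Hypothesis Ksym : forall a b, K a b = K b a.
Hypothesis Kpsd : forall x : 'I_n -> R, 0 <= \sum_a \sum_b K a b * (x a * x b).

(** At x + i y the form is its value at x plus its value at y, the cross terms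
    cancelling by symmetry. *)
Lemma real_form_complex_ge0 (z : 'I_n -> R[i]) :
  0 <= \sum_a \sum_b (K a b)%:C * (Num.conj (z a) * z b).
Proof.
pose x a := complex.Re (z a); pose y a := complex.Im (z a).
rewrite (eq_bigr (fun a => (\sum_b K a b * (x a * x b))%:C + (\sum_b K a b * (y a * y b))%:C
   + 'i * ((\sum_b K a b * (x a * y b))%:C - (\sum_b K a b * (y a * x b))%:C))); last first.
  move=> a _; rewrite !rmorph_sum/= -sumrB mulr_sumr -!big_split/=.
  apply: eq_bigr => b _; rewrite conj_mul_complexE/= !rmorphM !rmorphB !rmorphD/= !rmorphM/=; ring.
rewrite !big_split/= -mulr_sumr sumrB -!rmorph_sum/=.
rewrite [X in _ - X%:C](_ : _ = \sum_i \sum_b K i b * (x i * y b)).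
  by rewrite subrr mulr0 addr0 -rmorphD/= ler0c addr_ge0.
rewrite exchange_big/=; apply: eq_bigr => a _; apply: eq_bigr => b _.
by rewrite Ksym; ring.
Qed.

End hermitian_form.

Section doubly_stochastic.
Variables (R : rcfType) (n : nat) (M : 'I_n -> 'I_n -> R).
Hypothesis Msym : forall a b, M a b = M b a.
Hypothesis M_ge0 : forall a b, 0 <= M a b.
Hypothesis M1 : forall a, \sum_b M a b = 1.
Hypothesis Mpsd : forall x : 'I_n -> R, 0 <= \sum_a \sum_b M a b * (x a * x b).

Definition centered a b := M a b - n%:R^-1.
Local Notation K := centered.

Hypothesis n_gt0 : (0 < n)%N.
Let nD0 : n%:R != 0 :> R. Proof. by rewrite pnatr_eq0 -lt0n. Qed.

Lemma centered_sym a b : K a b = K b a. Proof. by rewrite /centered Msym. Qed.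

Lemma centered_row_sum a : \sum_b K a b = 0.
Proof. by rewrite sumrB M1 sumr_const card_ord -[_ *+ _]mulr_natr mulVf// subrr. Qed.

(** The centered form at x is the form of M at x minus the mean of x. *)
Lemma centered_psd (x : 'I_n -> R) : 0 <= \sum_a \sum_b K a b * (x a * x b).
Proof.
pose m := (\sum_a x a) / n%:R.
have -> : \sum_a \sum_b K a b * (x a * x b) =
          \sum_a \sum_b M a b * ((x a - m) * (x b - m)); last exact: Mpsd.
have sx : \sum_a x a = n%:R * m by rewrite /m mulrC divfK.
have rowx : \sum_a \sum_b M a b * x b = n%:R * m.
  rewrite exchange_big/= -sx; apply: eq_bigr => b _.
  by under eq_bigr do rewrite Msym; rewrite -mulr_suml M1 mul1r.
rewrite (eq_bigr (fun a => \sum_b M a b * (x a * x b) - n%:R^-1 * (x a * \sum_b x b))); last first.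
  by move=> a _; rewrite !mulr_sumr -sumrB; apply: eq_bigr => b _; rewrite /centered; ring.
rewrite [RHS](eq_bigr (fun a => \sum_b M a b * (x a * x b) - m * x a - m * (\sum_b M a b * x b) + m ^+ 2)); last first.
  move=> a _.
  rewrite (eq_bigr (fun b => M a b * (x a * x b) - m * (M a b * x b) -
    (m * x a) * M a b + m ^+ 2 * M a b)) => [|b _]; last by ring.
  rewrite !(big_split, sumrN)/= -!mulr_sumr M1 !mulr1; ring.
rewrite !(big_split, sumrN)/= -!mulr_sumr rowx -mulr_suml sx sumr_const card_ord -mulr_natr.
by field.
Qed.

(** This form is (sum x)^2 / n plus half the sum of the M a b (x a - x b)^2. *)
Lemma one_sub_centered_psd (x : 'I_n -> R) :
  0 <= \sum_a \sum_b ((a == b)%:R - K a b) * (x a * x b).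
Proof.
have sq0 : 0 <= (\sum_a x a) ^+ 2 / n%:R by rewrite divr_ge0 ?sqr_ge0.
have half : 0 <= \sum_a \sum_b M a b * (x a - x b) ^+ 2 / 2.
  by do 2 apply: sumr_ge0 => ? _; rewrite divr_ge0// mulr_ge0// sqr_ge0.
apply: (le_trans (addr_ge0 sq0 half)).
rewrite [X in _ + X <= _](eq_bigr (fun a => (2^-1 * x a ^+ 2 + \sum_b M a b * x b ^+ 2 / 2) - \sum_b M a b * (x a * x b))); last first.
  move=> a _; have -> : 2^-1 * x a ^+ 2 = \sum_b M a b * x a ^+ 2 / 2.
    by rewrite -!mulr_suml M1 mul1r mulrC.
  rewrite -big_split -sumrB/=.
  by apply: eq_bigr => b _; field.
rewrite sumrB big_split/= [X in _ + (_ + X - _)]exchange_big/=.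
rewrite [X in _ + (_ + X - _)](eq_bigr (fun b => 2^-1 * x b ^+ 2)); last first.
  move=> b _; under eq_bigr do rewrite Msym.
  by rewrite -!mulr_suml M1 mul1r mulrC.
rewrite [leRHS](eq_bigr (fun a => x a ^+ 2 - \sum_b M a b * (x a * x b) + n%:R^-1 * x a * \sum_b x b)); last first.
  move=> a _; rewrite (bigD1 a)//= eqxx [\sum_b M a b * _](bigD1 a)//= mulr_sumr [\sum_b _ * x b](bigD1 a)//=.
  rewrite (eq_bigr (fun b => - (M a b * (x a * x b)) + n%:R^-1 * x a * x b)) => [|b /negPf ab].
    rewrite big_split/= sumrN /centered; ring.
  by rewrite eq_sym ab /centered mulr0n; ring.
rewrite big_split sumrB/= -mulr_suml -!mulr_sumr le_eqVlt; apply/orP; left; apply/eqP.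
by field.
Qed.

Lemma centered_abs_le1 a b : `|K a b| <= 1.
Proof.
have M1' : M a b <= 1.
  by rewrite -(M1 a) (bigD1 b)//= lerDl sumr_ge0.
have ni0 : 0 <= n%:R^-1 :> R by rewrite invr_ge0.
have ni1 : n%:R^-1 <= 1 :> R by rewrite invf_le1 ?ltr0n// ler1n.
have := M_ge0 a b; rewrite ler_norml /centered; lra.
Qed.

End doubly_stochastic.

(** Positive semidefiniteness, in the form which is visibly stable under
    entrywise products. *)
Definition is_gram (R : pzRingType) n (K : 'I_n -> 'I_n -> R) :=
  exists (J : finType) (B : J -> 'I_n -> R), forall a b, K a b = \sum_j B j a * B j b.

Section spectral.
Variables (R : rcfType) (n : nat) (K : 'I_n -> 'I_n -> R).
Hypothesis Ksym : forall a b, K a b = K b a.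
Hypothesis Krow : forall a, \sum_b K a b = 0.
Hypothesis Kpsd : forall x : 'I_n -> R, 0 <= \sum_a \sum_b K a b * (x a * x b).
Hypothesis Kle1 : forall x : 'I_n -> R,
  0 <= \sum_a \sum_b ((a == b)%:R - K a b) * (x a * x b).

(** The eigenvectors may be complex; only the eigenvalues have to be real.  An
    eigenvector for a nonzero eigenvalue has sum zero because the columns of K
    do. *)
Lemma spectral_decomposition : exists (v : 'I_n -> 'I_n -> R[i]) (lam : 'I_n -> R),
  [/\ (forall c c', \sum_a v c a * Num.conj (v c' a) = (c == c')%:R) /\
      (forall a b, (K a b)%:C = \sum_c (lam c)%:C * v c a * Num.conj (v c b)),
      forall c, 0 <= lam c <= 1,
      forall c a, \sum_b (K a b)%:C * v c b = (lam c)%:C * v c a,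
      \sum_c lam c = \sum_a K a a &
      forall c, lam c != 0 -> \sum_a v c a = 0].
Proof.
pose A : 'M[R[i]]_n := \matrix_(a, b) (K a b)%:C.
have Areal : A \is a realmx.
  by apply/mxOverP => a b; rewrite mxE complex_real.
have Asym : A \is symmetricmx.
  apply/is_hermitianmxP; rewrite expr0 scale1r; apply/matrixP => a b.
  by rewrite !mxE Ksym.
have Aherm := realsym_hermsym Asym Areal.
have /orthomx_spectralP := hermitian_normalmx Aherm.
have /mxOverP sp_real := hermitian_spectral_diag_real Aherm.
have Pu := spectral_unitarymx A.
rewrite invmx_unitary//; set P := spectralmx A in Pu *; set sp := spectral_diag A in sp_real *.
move=> AE.
pose v c a := Num.conj (P c a).
pose lam c := complex.Re (sp 0 c).
have lamE c : sp 0 c = (lam c)%:C by rewrite RRe_real// sp_real.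
have orth c c' : \sum_a v c a * Num.conj (v c' a) = (c == c')%:R.
  have /unitarymxP/matrixP/(_ c' c) := Pu; rewrite !mxE eq_sym => <-.
  by apply: eq_bigr => a _; rewrite !mxE /v conjCK mulrC.
have KE a b : (K a b)%:C = \sum_c (lam c)%:C * v c a * Num.conj (v c b).
  have /matrixP/(_ a b) := AE; rewrite mxE => ->; rewrite !mxE.
  apply: eq_bigr => c _; rewrite mul_mx_diag !mxE /v conjCK lamE; congr (_ * _).
  by rewrite mulrC.
have Kv c a : \sum_b (K a b)%:C * v c b = (lam c)%:C * v c a.
  under eq_bigr do rewrite KE mulr_suml.
  rewrite exchange_big/= (bigD1 c)//= [X in _ + X]big1 ?addr0 => [|c' /negPf cc'].
    rewrite (eq_bigr (fun b => (lam c)%:C * v c a * (v c b * Num.conj (v c b)))).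
      by rewrite -mulr_sumr orth eqxx mulr1.
    by move=> b _; ring.
  rewrite (eq_bigr (fun b => (lam c')%:C * v c' a * (v c b * Num.conj (v c' b)))).
    by rewrite -mulr_sumr orth eq_sym cc' mulr0.
  by move=> b _; ring.
have formE c : \sum_a \sum_b (K a b)%:C * (Num.conj (v c a) * v c b) = (lam c)%:C.
  rewrite (eq_bigr (fun a => (lam c)%:C * (v c a * Num.conj (v c a)))).
    by rewrite -mulr_sumr orth eqxx mulr1.
  move=> a _; rewrite mulrA -Kv mulr_suml; apply: eq_bigr => b _; ring.
exists v, lam; split => // [c||c lam0].
- apply/andP; split.
    by have := real_form_complex_ge0 Ksym Kpsd (v c); rewrite formE ler0c.
  have := @real_form_complex_ge0 _ _ (fun a b => (a == b)%:R - K a b) _ Kle1 (v c).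
  rewrite (eq_bigr (fun a => v c a * Num.conj (v c a) -
     \sum_b (K a b)%:C * (Num.conj (v c a) * v c b))).
    rewrite sumrB formE orth eqxx (_ : 1 = 1%:C)// -rmorphB/= ler0c subr_ge0; apply.
    by move=> a b; rewrite eq_sym Ksym.
  move=> a _; rewrite (bigD1 a)//= eqxx [in RHS](bigD1 a)//=.
  rewrite (eq_bigr (fun b => - ((K a b)%:C * (Num.conj (v c a) * v c b)))).
    by rewrite sumrN rmorphB/= rmorph1; ring.
  by move=> b /negPf; rewrite eq_sym => ->; rewrite mulr0n sub0r rmorphN/= mulNr.
- apply: complexI; rewrite !rmorph_sum/=; under [RHS]eq_bigr do rewrite KE.
  rewrite exchange_big/=; apply: eq_bigr => c _.
  by under eq_bigr do rewrite -mulrA; rewrite -mulr_sumr orth eqxx mulr1.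
- have : (lam c)%:C * \sum_a v c a = 0.
    rewrite mulr_sumr; under eq_bigr do rewrite -Kv.
    rewrite exchange_big/= big1// => b _.
    rewrite -mulr_suml -rmorph_sum/=; under eq_bigr do rewrite Ksym.
    by rewrite Krow mul0r.
  move/eqP; rewrite mulf_eq0 => /orP[|/eqP//].
  by rewrite (_ : 0 = 0%:C)// (inj_eq (@complexI _)) (negPf lam0).
Qed.

Let T := \sum_a K a a.

Lemma trace_ge0 : 0 <= T.
Proof.
have [v [lam [_ lam01 _ lamT _]]] := spectral_decomposition.
by rewrite /T -lamT sumr_ge0// => c _; have /andP[] := lam01 c.
Qed.

Lemma sum_sqr_le_trace : \sum_a \sum_b K a b ^+ 2 <= T.
Proof.
have [v [lam [[orth KE] lam01 Kv lamT _]]] := spectral_decomposition.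
have -> : \sum_a \sum_b K a b ^+ 2 = \sum_c lam c ^+ 2.
  apply: complexI; rewrite !rmorph_sum/=.
  rewrite (eq_bigr (fun a => \sum_c ((lam c) ^+ 2)%:C * (v c a * Num.conj (v c a)))).
    rewrite exchange_big/=; apply: eq_bigr => c _.
    by rewrite -mulr_sumr orth eqxx mulr1.
  move=> a _; rewrite rmorph_sum/=.
  rewrite (eq_bigr (fun b => \sum_c (lam c)%:C * Num.conj (v c a) * ((K a b)%:C * v c b))).
    rewrite exchange_big/=; apply: eq_bigr => c _.
    by rewrite -mulr_sumr Kv rmorphXn/=; ring.
  move=> b _; rewrite expr2 rmorphM/= {2}Ksym [X in _ * X]KE mulr_sumr.
  by apply: eq_bigr => c _; ring.
rewrite /T -lamT; apply: ler_sum => c _; have /andP[l0 l1] := lam01 c.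
by rewrite expr2 ler_piMr.
Qed.

(** The real and imaginary parts of the eigenvectors, scaled by the square
    roots of the eigenvalues. *)
Lemma spectral_gram : is_gram K.
Proof.
have [v [lam [[orth KE] lam01 Kv lamT _]]] := spectral_decomposition.
exists ('I_n * bool)%type, (fun j a => Num.sqrt (lam j.1) *
  (if j.2 then complex.Re (v j.1 a) else complex.Im (v j.1 a))).
move=> a b; rewrite -(pair_bigA _ (fun c r => Num.sqrt (lam c) *
  (if r then complex.Re (v c a) else complex.Im (v c a)) * (Num.sqrt (lam c) *
  (if r then complex.Re (v c b) else complex.Im (v c b)))))/=.
have /(congr1 (@complex.Re R)) := KE b a; rewrite Ksym/= => ->.
rewrite (eq_bigr (fun c => (lam c * (complex.Re (v c a) * complex.Re (v c b) + complex.Im (v c a) * complex.Im (v c b)))%:C +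
 'i * (lam c * (complex.Re (v c a) * complex.Im (v c b) - complex.Im (v c a) * complex.Re (v c b)))%:C)).
  rewrite big_split/= -mulr_sumr -!rmorph_sum/= mul0r mul1r subr0 addr0.
  apply: eq_bigr => c _; rewrite big_bool/=.
  have /andP[l0 _] := lam01 c; rewrite -[in LHS](sqr_sqrtr l0); ring.
move=> c _; rewrite -mulrA [v c b * _]mulrC conj_mul_complexE mulrDr mulrCA.
by rewrite -!rmorphM.
Qed.

(** An eigenvalue is at most 1, and also at most T since all of them are
    nonnegative with sum T; the first bound matters for large T, the second
    one for small T. *)
Lemma overlap_sum_le l : (l <= n)%N ->
  overlap_sum K l <= ((n - l)`! ^ 2 * 16 ^ l)%:R *
    \prod_(i < l) (T + i%:R * Num.min 1 T).
Proof.
move=> ln.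
have [v [lam [[orth KE] lam01 _ lamT lam0]]] := spectral_decomposition.
rewrite -lecR.
have -> : (overlap_sum K l)%:C =
    overlap_sum (fun a b => \sum_c (lam c)%:C * v c a * Num.conj (v c b)) l.
  rewrite /overlap_sum !rmorph_sum/=; apply: eq_bigr => s _.
  rewrite !rmorph_sum/=; apply: eq_bigr => t _.
  by rewrite rmorph_prod/=; apply: eq_bigr => i _; rewrite KE.
apply: (le_trans (@spectral_overlap_sum_le _ n v orth (fun c => (lam c)%:C) _ _ l (Num.min 1 T)%:C ln _)).
- by move=> c; rewrite ler0c; have /andP[] := lam01 c.
- by move=> c; rewrite (_ : 0 = 0%:C)// (inj_eq (@complexI _)) => /lam0.
- move=> c; rewrite lecR le_min; have /andP[_ ->] := lam01 c.
  rewrite /T -lamT (bigD1 c)//= lerDl sumr_ge0// => c' _.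
  by have /andP[] := lam01 c'.
rewrite [leRHS]rmorphM rmorph_nat -rmorph_sum/= lamT rmorph_prod/=.
rewrite le_eqVlt; apply/orP; left; apply/eqP; congr (_ * _); apply: eq_bigr => i _.
by rewrite rmorphD rmorphM rmorph_nat.
Qed.

End spectral.

Local Close Scope complex_scope.

(** * A recursion for overlap sums with few factors *)

Lemma is_gramM (R : comPzRingType) n (K L : 'I_n -> 'I_n -> R) :
  is_gram K -> is_gram L -> is_gram (fun a b => K a b * L a b).
Proof.
move=> [J [B KE]] [G [Y LE]].
exists (J * G)%type, (fun p a => B p.1 a * Y p.2 a) => a b.
rewrite -(pair_bigA _ (fun j g => B j a * Y g a * (B j b * Y g b)))/= KE LE big_distrlr/=.
by apply: eq_bigr => j _; apply: eq_bigr => g _; ring.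
Qed.

Lemma is_gramX (R : comPzRingType) n (K : 'I_n -> 'I_n -> R) p :
  is_gram K -> is_gram (fun a b => K a b ^+ p.+1).
Proof.
move=> Kg; elim: p => [//|p IH].
have [J [B BE]] := is_gramM Kg IH.
by exists J, B => a b; rewrite exprS BE.
Qed.

(** The last position carries a kernel of its own, because in the recursion
    the entrywise powers of K accumulate there. *)
Definition marked_sum (A : pzSemiRingType) n (K L : 'I_n -> 'I_n -> A) l : A :=
  \sum_(s : {perm 'I_n}) \sum_(t : {perm 'I_n})
    (\prod_(i < n | (i < l)%N) K (s i) (t i)) * \prod_(i < n | i == l :> nat) L (s i) (t i).

Lemma overlap_sumS (A : comPzSemiRingType) n (K : 'I_n -> 'I_n -> A) l :
  overlap_sum K l.+1 = marked_sum K K l.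
Proof.
apply: eq_bigr => s _; apply: eq_bigr => t _.
rewrite (bigID (fun i : 'I_n => (i < l)%N))/=; congr (_ * _); apply: eq_bigl => i.
  by case: (ltnP i l) => il; rewrite ?andbF// andbT ltnS ltnW.
by rewrite -leqNgt ltnS -eqn_leq.
Qed.

Section recursion.
Variables (R : realFieldType) (n : nat) (K L : 'I_n -> 'I_n -> R).
Hypotheses (Kg : is_gram K) (Lg : is_gram L).

(** Read from right to left, the sum is one of squares: inequalities between
    squares, proved for each m and g, become inequalities between overlap
    sums. *)
Lemma sum_gram_sqr (J G : finType) (B : J -> 'I_n -> R) (Z : G -> {perm 'I_n} -> R) l
    (ln : (l <= n)%N) : (forall a b, K a b = \sum_j B j a * B j b) ->
  \sum_(m : {ffun 'I_l -> J}) \sum_g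
    (\sum_(s : {perm 'I_n}) (\prod_i B (m i) (s (widen_ord ln i))) * Z g s) ^+ 2 =
  \sum_(s : {perm 'I_n}) \sum_(t : {perm 'I_n})
    (\prod_(i < n | (i < l)%N) K (s i) (t i)) * \sum_g Z g s * Z g t.
Proof.
move=> KE.
under eq_bigr do under eq_bigr do rewrite expr2 big_distrlr/=.
under eq_bigr do rewrite exchange_big/=.
rewrite exchange_big/=; apply: eq_bigr => s _.
under eq_bigr do rewrite exchange_big/=.
rewrite exchange_big/=; apply: eq_bigr => t _.
rewrite big_ord_narrow (eq_bigr (fun i : 'I_l => \sum_j B j (s (widen_ord ln i)) * B j (t (widen_ord ln i)))) => [|i _]; last by rewrite KE.
rewrite bigA_distr_bigA/= big_distrlr/=; apply: eq_bigr => m _; apply: eq_bigr => g _.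
by rewrite big_split/=; ring.
Qed.

Lemma overlap_sum_ge0 l : (l <= n)%N -> 0 <= overlap_sum K l.
Proof.
move=> ln; have [J [B KE]] := Kg.
have := sum_gram_sqr (fun (_ : unit) _ => 1) ln KE.
have -> : overlap_sum K l = \sum_(s : {perm 'I_n}) \sum_(t : {perm 'I_n})
    (\prod_(i < n | (i < l)%N) K (s i) (t i)) * \sum_(g : unit) 1 * 1.
  apply: eq_bigr => s _; apply: eq_bigr => t _.
  by rewrite big_const card_unit/= addr0 !mulr1.
by move=> <-; apply: sumr_ge0 => m _; apply: sumr_ge0 => g _; exact: sqr_ge0.
Qed.

(** Given the values of s at the first l positions, s p is uniform among the
    n - l others; hence y (s p) has mean 1 / (n - l) times the total of y less
    the part of it sitting at the first l positions. *)
Lemma perm_sum_resample (U : {perm 'I_n} -> R) (y : 'I_n -> R) l (p : 'I_n) :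
  (l <= p)%N ->
  (forall s t : {perm 'I_n}, (forall i : 'I_n, (i < l)%N -> s i = t i) -> U s = U t) ->
  (n - l)%:R * \sum_(s : {perm 'I_n}) U s * y (s p) =
  \sum_(s : {perm 'I_n}) U s * ((\sum_a y a) - \sum_(i < n | (i < l)%N) y (s i)).
Proof.
move=> lp Ul.
transitivity (\sum_(s : {perm 'I_n}) U s * \sum_(i < n | (l <= i)%N) y (s i)); last first.
  apply: eq_bigr => s _; congr (_ * _).
  rewrite [X in _ = X - _](reindex_inj (@perm_inj _ s))/=.
  rewrite [X in _ = X - _](bigID (fun i : 'I_n => (i < l)%N))/= addrAC subrr add0r.
  by apply: eq_bigl => i; rewrite leqNgt.
under [RHS]eq_bigr do rewrite mulr_sumr.
rewrite exchange_big/= mulr_natl -sumr_const_nat big_geq_mkord/=.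
apply: eq_bigr => i li; rewrite (reindex_inj (mulgI (tperm p i)))/=.
apply: eq_bigr => s _; rewrite permM tpermL; congr (_ * _); apply: Ul => j jl.
by rewrite permM tpermD//; apply: contraTneq jl => <-; rewrite -leqNgt.
Qed.

Lemma marked_sum_relocate l (j : 'I_n) : (l < n)%N -> (j < l.+1)%N ->
  \sum_(s : {perm 'I_n}) \sum_(t : {perm 'I_n})
    (\prod_(i < n | (i < l.+1)%N) K (s i) (t i)) * L (s j) (t j) =
  marked_sum K (fun a b => K a b * L a b) l.
Proof.
move=> ln jl; pose p := Ordinal ln.
rewrite (reindex_inj (mulgI (tperm j p)))/=; apply: eq_bigr => s _.
rewrite (reindex_inj (mulgI (tperm j p)))/=; apply: eq_bigr => t _.
rewrite !permM tpermL [X in _ = _ * X](big_pred1 p)//.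
rewrite mulrA; congr (_ * _).
rewrite (reindex_inj (@perm_inj _ (tperm j p))) (bigD1 p)/=; last by rewrite tpermR.
rewrite mulrC permM tpermK permM tpermK; congr (_ * _).
apply: eq_big => [i|i _]; last by rewrite !permM !tpermK.
case: tpermP => [->|->|/eqP ij /eqP ip].
- rewrite ltnSn/= ltn_neqAle -[(j <= l)%N]ltnS jl andbT -val_eqE/=.
  by [].
- by rewrite eqxx andbF ltnn.
- by rewrite ltnS [RHS]ltn_neqAle -val_eqE/= andbC.
Qed.

(** Resampling the marked position produces the total of L and l further terms
    in which the mark lies on an earlier position, where L multiplies K; these
    are all equal by symmetry.  The squares are separated by the
    Cauchy-Schwarz inequality.  For L = K the total vanishes: this is the gain
    from centering. *)
Lemma marked_sum_le l : (l < n)%N ->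
  (n - l)%:R ^+ 2 * marked_sum K L l <=
  2 * (\sum_a \sum_b L a b) * overlap_sum K l +
  2 * l%:R ^+ 2 * marked_sum K (fun a b => K a b * L a b) l.-1.
Proof.
move=> ln; have [J [B KE]] := Kg; have [G [Y LE]] := Lg.
have lnW := ltnW ln; pose p := Ordinal ln.
pose U (m : {ffun 'I_l -> J}) (s : {perm 'I_n}) := \prod_i B (m i) (s (widen_ord lnW i)).
have UP m (s t : {perm 'I_n}) : (forall i : 'I_n, (i < l)%N -> s i = t i) -> U m s = U m t.
  by move=> st; apply: eq_bigr => i _; rewrite st //=.
have ptw m g : (n - l)%:R ^+ 2 * (\sum_s U m s * Y g (s p)) ^+ 2 <=
   2 * (\sum_s U m s * \sum_a Y g a) ^+ 2 +
   2 * l%:R * \sum_(j < l) (\sum_s U m s * Y g (s (widen_ord lnW j))) ^+ 2.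
  rewrite -exprMn (@perm_sum_resample (U m) (Y g) l p (leqnn l) (UP m)).
  under eq_bigr do rewrite mulrBr big_ord_narrow [X in _ - X]mulr_sumr.
  rewrite sumrB [X in _ - X]exchange_big/=.
  pose x := \sum_s U m s * \sum_a Y g a.
  pose z j := \sum_s U m s * Y g (s (widen_ord lnW j)).
  suff : (x - \sum_j z j) ^+ 2 <= 2 * x ^+ 2 + 2 * l%:R * \sum_j z j ^+ 2 by [].
  have := @sqr_sum_le R _ z; rewrite card_ord => zle.
  have : 0 <= (x + \sum_j z j) ^+ 2 by exact: sqr_ge0.
  rewrite -mulrA; move: (\sum_j z j) (l%:R * _) zle => u w; nra.
have : (n - l)%:R ^+ 2 * \sum_m \sum_g (\sum_s U m s * Y g (s p)) ^+ 2 <=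
   2 * \sum_m \sum_g (\sum_s U m s * \sum_a Y g a) ^+ 2 +
   2 * l%:R * \sum_(j < l) \sum_m \sum_g (\sum_s U m s * Y g (s (widen_ord lnW j))) ^+ 2.
  rewrite [X in _ + _ * X]exchange_big/= !mulr_sumr -big_split/=; apply: ler_sum => m _.
  rewrite [X in _ + _ * X]exchange_big/= !mulr_sumr -big_split/=; apply: ler_sum => g _.
  exact: ptw.
rewrite (sum_gram_sqr (fun g s => Y g (s p)) lnW KE).
rewrite (sum_gram_sqr (fun g _ => \sum_a Y g a) lnW KE)/=.
have -> : \sum_(s : {perm 'I_n}) \sum_(t : {perm 'I_n})
     (\prod_(i < n | (i < l)%N) K (s i) (t i)) * (\sum_g Y g (s p) * Y g (t p)) = marked_sum K L l.
  apply: eq_bigr => s _; apply: eq_bigr => t _; rewrite [X in _ = _ * X](big_pred1 p)// LE.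
  by [].
have -> : \sum_(s : {perm 'I_n}) \sum_(t : {perm 'I_n})
    (\prod_(i < n | (i < l)%N) K (s i) (t i)) * (\sum_g (\sum_a Y g a) * (\sum_a Y g a)) =
    (\sum_a \sum_b L a b) * overlap_sum K l.
  rewrite mulr_sumr; apply: eq_bigr => s _; rewrite mulr_sumr; apply: eq_bigr => t _.
  rewrite mulrC; congr (_ * _).
  under [RHS]eq_bigr do under eq_bigr do rewrite LE.
  under [RHS]eq_bigr do rewrite exchange_big/=.
  rewrite exchange_big/=; apply: eq_bigr => g _.
  by rewrite big_distrlr.
rewrite mulrA => /le_trans; apply; rewrite lerD2l.
rewrite (eq_bigr (fun=> marked_sum K (fun a b => K a b * L a b) l.-1)) => [|j _].
  rewrite sumr_const card_ord -[_ *+ l]mulr_natl le_eqVlt.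
  by apply/orP; left; apply/eqP; ring.
have l0 : (0 < l)%N by exact: leq_ltn_trans (ltn_ord j).
rewrite (sum_gram_sqr (fun g s => Y g (s (widen_ord lnW j))) lnW KE).
have lp : (l.-1 < n)%N by rewrite prednK.
have jl : (j < l.-1.+1)%N by rewrite prednK.
rewrite -(@marked_sum_relocate l.-1 (widen_ord lnW j) lp jl) prednK//.
by apply: eq_bigr => s _; apply: eq_bigr => t _; rewrite LE.
Qed.

End recursion.

Lemma overlap_sum0 (R : pzSemiRingType) n (K : 'I_n -> 'I_n -> R) :
  overlap_sum K 0 = (n`! ^ 2)%:R.
Proof.
rewrite /overlap_sum (eq_bigr (fun=> (n`!)%:R)) => [|s _].
  by rewrite sumr_const card_Sn -mulrnA.
rewrite (eq_bigr (fun=> 1)) => [|t _]; first by rewrite sumr_const card_Sn.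
by rewrite big_pred0.
Qed.

(** * The bound on overlap sums *)

Section centered_kernel.
Variables (R : rcfType) (n : nat) (K : 'I_n -> 'I_n -> R).
Hypothesis Ksym : forall a b, K a b = K b a.
Hypothesis Krow : forall a, \sum_b K a b = 0.
Hypothesis Kpsd : forall x : 'I_n -> R, 0 <= \sum_a \sum_b K a b * (x a * x b).
Hypothesis Kle1 : forall x : 'I_n -> R,
  0 <= \sum_a \sum_b ((a == b)%:R - K a b) * (x a * x b).
Hypothesis Kabs : forall a b, `|K a b| <= 1.

Local Notation T := (\sum_a K a a).
Let Kgram : is_gram K := spectral_gram Ksym Krow Kpsd Kle1.

(** Entries of modulus at most 1 reduce this to the Hilbert-Schmidt norm. *)
Lemma sum_centered_power_le p : \sum_a \sum_b K a b ^+ p.+2 <= T.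
Proof.
apply: le_trans (sum_sqr_le_trace Ksym Krow Kpsd Kle1).
apply: ler_sum => a _; apply: ler_sum => b _.
rewrite -addn2 exprD ler_piMl ?sqr_ge0// (le_trans (ler_norm _))//.
by rewrite normrX exprn_ile1.
Qed.

Let norm_fact l : R := ((n - l)`! ^ 2)%:R.

Let norm_fact_gt0 l : 0 < norm_fact l.
Proof. by rewrite ltr0n expn_gt0 fact_gt0. Qed.

Let norm_factS l : (l < n)%N -> (n - l)%:R ^+ 2 * norm_fact l.+1 = norm_fact l.
Proof.
move=> ln; rewrite /norm_fact -natrX -natrM -expnMn; congr ((_ ^ 2)%:R).
have d0 : (0 < n - l)%N by rewrite subn_gt0.
by rewrite subnS -[in RHS](prednK d0) factS (prednK d0).
Qed.

Let mark_le L l (X Y Z : R) : is_gram L -> (l < n)%N ->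
  2 * (\sum_a \sum_b L a b) * overlap_sum K l <= norm_fact l * Y ->
  2 * l%:R ^+ 2 * marked_sum K (fun a b => K a b * L a b) l.-1 <= norm_fact l * Z ->
  Y + Z <= X -> marked_sum K L l <= norm_fact l.+1 * X.
Proof.
move=> Lg ln hY hZ hX; have h := marked_sum_le Kgram Lg ln.
have n2 : 0 < (n - l)%:R ^+ 2 :> R by rewrite exprn_gt0// ltr0n subn_gt0.
rewrite -(ler_pM2l n2); apply: (le_trans h).
rewrite [leRHS]mulrA norm_factS// (le_trans (lerD hY hZ))//.
by rewrite -mulrDr ler_wpM2l// ltW.
Qed.

(** The recursion, started at L = K.  The first step has no term from the total
    and leaves the kernel K ^ 2; each further step either removes the marked
    position, at the price of a factor sum K ^ p <= T, or merges it with one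
    of l others and raises p.  As the removal of two positions costs T, each
    position costs sqrt T; merging three or more positions costs a relative
    factor l / sqrt T per additional one, whence the restriction on l.  The
    three assertions are proved together because the one on the kernel K ^ p
    for l uses the first one for l, and the second one uses the third one for
    l - 1. *)
Lemma small_overlap_sum_le l (t := Num.sqrt T) : 1 <= T -> l%:R <= t ->
  [/\ (l <= n)%N -> overlap_sum K l <= norm_fact l * (l`!%:R * (4 * t) ^+ l),
      (l < n)%N -> overlap_sum K l.+1 <= norm_fact l.+1 * (l.+1`!%:R * (4 * t) ^+ l.+1) &
      (l < n)%N -> forall p, marked_sum K (fun a b => K a b ^+ p.+2) l <=
        norm_fact l.+1 * (l`!%:R * (4 * t ^+ 2) * (4 * t) ^+ l)].
Proof.
move=> T1 lt.
have t1 : 1 <= t by rewrite -sqrtr1 ler_wsqrtr.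
have t0 : 0 < t by apply: lt_le_trans t1.
have Tt : T = t ^+ 2 by rewrite sqr_sqrtr// (le_trans ler01).
have S0 : \sum_a \sum_b K a b = 0 by apply: big1 => a _; exact: Krow.
have Sp p : \sum_a \sum_b K a b ^+ p.+2 <= t ^+ 2 by rewrite -Tt sum_centered_power_le.
have P0 l' : 0 <= (4 * t) ^+ l' by rewrite exprn_ge0// mulr_ge0// ltW.
(* Both steps reduce to the nonnegativity of a multiple of G. *)
pose G l' := l'`!%:R * (t ^+ 2 * (4 * t) ^+ l').
have G0 l' : 0 <= G l' by apply: mulr_ge0 => //; apply: mulr_ge0 => //; exact: sqr_ge0.
elim: l lt => [|l IH] lt.
  have A0 : overlap_sum K 0 = norm_fact 0 by rewrite overlap_sum0 /norm_fact subn0.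
  split=> [_|n0|n0 p].
  - by rewrite A0 !mulr1.
  - rewrite overlap_sumS; apply: (@mark_le K 0 _ 0 0) => //.
    + by rewrite S0 !mulr0 mul0r.
    + by rewrite expr0n/= !mulr0 mul0r.
    + by rewrite addr0 mulr_ge0.
  - apply: (@mark_le _ 0 _ (2 * t ^+ 2) 0) => //.
    + exact: is_gramX.
    + rewrite A0 mulrC (ler_wpM2l (ltW (norm_fact_gt0 0)))// ler_wpM2l//.
    + by rewrite expr0n/= !mulr0 mul0r.
    + by rewrite expr0 fact0 mul1r mulr1 addr0; have := sqr_ge0 t; lra.
have lt' : l%:R <= t by rewrite (le_trans _ lt)// ler_nat.
have [_ IHa IHb] := IH lt'; split=> [//|ln|ln p].
- have ln' := ltnW ln; rewrite overlap_sumS.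
  apply: (@mark_le K l.+1 _ 0 (2 * l.+1%:R ^+ 2 * (l`!%:R * (4 * t ^+ 2) * (4 * t) ^+ l))) => //.
  + by rewrite S0 !mulr0 mul0r.
  + by rewrite [leRHS]mulrCA ler_wpM2l ?mulr_ge0 ?sqr_ge0// (IHb ln' 0).
  + have -> : l.+2`!%:R = (l.+1%:R + 1) * (l.+1%:R * l`!%:R) :> R.
      by rewrite !factS !natrM natr1.
    rewrite !(exprS (4 * t)) add0r -subr_ge0.
    rewrite (_ : _ - _ = 8 * G l * (l.+1%:R * (l.+1%:R + 2))).
      by apply: mulr_ge0; [apply: mulr_ge0|rewrite mulr_ge0// addr_ge0].
    by rewrite /G; ring.
- have ln' := ltnW ln.
  apply: (@mark_le _ l.+1 _ (2 * t ^+ 2 * (l.+1`!%:R * (4 * t) ^+ l.+1))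
    (2 * l.+1%:R ^+ 2 * (l`!%:R * (4 * t ^+ 2) * (4 * t) ^+ l))) => //.
  + exact: is_gramX.
  + rewrite [leRHS]mulrCA; apply: (@le_trans _ _ (2 * t ^+ 2 * overlap_sum K l.+1)).
      by rewrite ler_wpM2r ?overlap_sum_ge0// ler_wpM2l.
    by rewrite ler_wpM2l ?IHa// mulr_ge0// sqr_ge0.
  + rewrite [leRHS]mulrCA ler_wpM2l ?mulr_ge0 ?sqr_ge0//.
    exact: (IHb ln' p.+1).
  + rewrite factS natrM (exprS (4 * t)) -subr_ge0.
    rewrite (_ : _ - _ = 8 * G l * (l.+1%:R * (t - l.+1%:R))).
      by apply: mulr_ge0; [apply: mulr_ge0|rewrite mulr_ge0// subr_ge0].
    by rewrite /G; ring.
Qed.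

End centered_kernel.

(** * From overlap sums to the chi-squared divergence *)

Section expansion.
Variables (A : comPzRingType) (n : nat) (K : 'I_n -> 'I_n -> A).

Let mixed l r := \sum_(s : {perm 'I_n}) \sum_(t : {perm 'I_n})
  (\prod_(i < n | (i < l)%N) K (s i) (t i)) *
  \prod_(i < n | (l <= i < l + r)%N) (1 + K (s i) (t i)).

Let mixed0 l : mixed l 0 = overlap_sum K l.
Proof.
apply: eq_bigr => s _; apply: eq_bigr => t _; rewrite [X in _ * X]big_pred0 ?mulr1// => i.
by rewrite addn0 ltnNge andbN.
Qed.

Let mixedS l r : (l + r < n)%N -> mixed l r.+1 = mixed l r + mixed l.+1 r.
Proof.
move=> lrn; have ln : (l < n)%N by apply: leq_ltn_trans lrn; rewrite leq_addr.
pose p := Ordinal lrn; pose q := Ordinal ln.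
transitivity (mixed l r + \sum_(s : {perm 'I_n}) \sum_(t : {perm 'I_n})
    (\prod_(i < n | (i < l)%N) K (s i) (t i)) * K (s p) (t p) *
    \prod_(i < n | (l <= i < l + r)%N) (1 + K (s i) (t i))).
  rewrite -big_split; apply: eq_bigr => s _; rewrite -big_split; apply: eq_bigr => t _ /=.
  rewrite [X in _ * X = _](bigD1 p)/=; last by rewrite leq_addr addnS leqnn.
  rewrite [X in _ * (_ * X)](eq_bigl (fun i : 'I_n => (l <= i < l + r)%N)); first by ring.
  move=> i; rewrite addnS ltnS -val_eqE/=; lia.
congr (_ + _); rewrite [RHS](reindex_inj (mulgI (tperm q p))); apply: eq_bigr => s _.
rewrite [RHS](reindex_inj (mulgI (tperm q p))); apply: eq_bigr => t _ /=.
have tK := tpermK q p.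
rewrite [X in _ = X * _](reindex_inj (@perm_inj _ (tperm q p))).
rewrite [X in _ = _ * X](reindex_inj (@perm_inj _ (tperm q p)))/=.
under [X in _ = X * _]eq_bigr do rewrite !permM !tK.
under [X in _ = _ * X]eq_bigr do rewrite !permM !tK.
congr (_ * _).
  rewrite [RHS](bigD1 p)/= ?tpermR// mulrC; congr (_ * _).
  apply: eq_bigl => i; case: tpermP => [->|->|/eqP + /eqP]; rewrite -?val_eqE/=; lia.
apply: eq_bigl => i; case: tpermP => [->|->|/eqP + /eqP]; rewrite -?val_eqE/=; lia.
Qed.

(** Splitting one factor 1 + K at a time, and moving its position next to those
    of the factors K already present, is Pascal's rule for the binomial
    coefficients. *)
Lemma prod_add1_expansion k : (k <= n)%N ->
  \sum_(s : {perm 'I_n}) \sum_(t : {perm 'I_n}) \prod_(i < n | (i < k)%N) (1 + K (s i) (t i)) =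
  \sum_(l < k.+1) overlap_sum K l *+ 'C(k, l).
Proof.
move=> kn; transitivity (mixed 0 k).
  by apply: eq_bigr => s _; apply: eq_bigr => t _; rewrite [X in _ = X * _]big_pred0 ?mul1r.
have : forall l r, (l + r <= n)%N -> mixed l r = \sum_(j < r.+1) overlap_sum K (l + j) *+ 'C(r, j).
  move=> l r; elim: r l => [|r IH] l lrn.
    by rewrite big_ord1 mixed0 addn0.
  have lrn1 : (l + r < n)%N by rewrite -addnS.
  rewrite mixedS// IH ?(ltnW lrn1)// IH ?addSn//.
  rewrite [RHS]big_ord_recl bin0 [in LHS]big_ord_recl bin0 -addrA; congr (_ + _).
  under [RHS]eq_bigr do rewrite lift0 binS mulrnDr.
  rewrite big_split/= [X in _ = X + _]big_ord_recr/= bin_small// mulr0n addr0.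
  congr (_ + _).
  by apply: eq_bigr => j _; rewrite addSnnS.
by move=> /(_ 0 k kn) ->.
Qed.

End expansion.

Section bound.
Variables (R : rcfType) (n : nat) (K : 'I_n -> 'I_n -> R).
Hypothesis Ksym : forall a b, K a b = K b a.
Hypothesis Krow : forall a, \sum_b K a b = 0.
Hypothesis Kpsd : forall x : 'I_n -> R, 0 <= \sum_a \sum_b K a b * (x a * x b).
Hypothesis Kle1 : forall x : 'I_n -> R,
  0 <= \sum_a \sum_b ((a == b)%:R - K a b) * (x a * x b).
Hypothesis Kabs : forall a b, `|K a b| <= 1.

Local Notation T := (\sum_a K a a).
Let tau := Num.sqrt (Num.min (T ^+ 2) T).

(** Here tau is T if T <= 1 and sqrt T otherwise.  For T <= 1 the spectral bound
    has factors T + i T, with product l! T ^ l.  For T >= 1 its factors T + i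
    are at most 2 l sqrt T once l >= sqrt T, which suffices because
    l ^ l <= 4 ^ l l!; for l <= sqrt T the spectral bound is too weak and the
    recursion is used. *)
Lemma overlap_sum_bound l : (l <= n)%N ->
  overlap_sum K l <= ((n - l)`! ^ 2)%:R * (l`!%:R * (128 * tau) ^+ l).
Proof.
move=> ln; have T0 : 0 <= T by exact: (trace_ge0 Ksym Krow Kpsd Kle1).
have := overlap_sum_le Ksym Krow Kpsd Kle1 ln.
rewrite natrM -mulrA => A_le.
have F0 : 0 <= ((n - l)`! ^ 2)%:R :> R by [].
have lift_le (b c : R) : 0 <= b -> b <= c -> l`!%:R * b ^+ l <= l`!%:R * c ^+ l.
  by move=> b0 bc; rewrite ler_wpM2l// lerXn2r// nnegrE// (le_trans b0).
have [T1|T1] := leP T 1.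
  have tauE : tau = T.
    rewrite /tau (min_idPl _) ?sqrtr_sqr ?ger0_norm//.
    by rewrite expr2 ler_piMl.
  apply: (le_trans A_le); rewrite ler_wpM2l// (min_idPr T1) tauE.
  have -> : \prod_(i < l) (T + i%:R * T) = l`!%:R * T ^+ l.
    elim: (l) => [|m IH]; first by rewrite big_ord0 mulr1.
    by rewrite big_ord_recr/= IH factS natrM exprS -natr1; ring.
  rewrite mulrCA natrX -exprMn; apply: lift_le; first by rewrite mulr_ge0.
  by rewrite ler_wpM2r// ler_nat.
have tauE : tau = Num.sqrt T.
  by rewrite /tau (min_idPr _)// expr2 ler_peMl// ltW.
rewrite tauE; set t := Num.sqrt T in tauE *.
have t0 : 0 <= t by exact: sqrtr_ge0.
have [lt|tl] := leP l%:R t.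
  have [/(_ ln) + _ _] := small_overlap_sum_le Ksym Krow Kpsd Kle1 Kabs (ltW T1) lt.
  move=> /le_trans; apply; rewrite ler_wpM2l//; apply: lift_le; first by rewrite mulr_ge0.
  by rewrite ler_wpM2r// ler_nat.
apply: (le_trans A_le); rewrite ler_wpM2l// (min_idPl (ltW T1)).
have t1 : 1 <= t by rewrite -sqrtr1 ler_wsqrtr// ltW.
have Tt : T = t ^+ 2 by rewrite sqr_sqrtr.
have : \prod_(i < l) (T + i%:R * 1) <= (2 * l%:R * t) ^+ l.
  rewrite -[X in _ ^+ X]card_ord -prodr_const; apply: ler_prod => i _.
  rewrite addr_ge0 ?mulr_ge0//= mulr1 Tt.
  have il : i%:R <= l%:R :> R by rewrite ler_nat ltnW.
  nra.
move=> /(ler_wpM2l (_ : 0 <= (16 ^ l)%:R)) /le_trans; apply; first by [].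
rewrite -mulrA [(l%:R * t)]mulrC mulrA exprMn mulrA -natrX.
have ll : (l ^ l)%:R <= (4 ^ l * l`!)%:R :> R by rewrite ler_nat expnn_le.
have p0 : 0 <= (16 ^ l)%:R * (2 * t) ^+ l by rewrite mulr_ge0// exprn_ge0// mulr_ge0.
apply: (le_trans (ler_wpM2l p0 ll)).
rewrite natrM mulrA mulrC ler_wpM2l// !natrX -!exprMn.
by rewrite lerXn2r// ?nnegrE ?mulr_ge0//; lra.
Qed.

End bound.

Section doubly_stochastic.
Variables (R : rcfType) (n k : nat) (M : 'I_n -> 'I_n -> R).
Hypothesis Msym : forall a b, M a b = M b a.
Hypothesis M_ge0 : forall a b, 0 <= M a b.
Hypothesis M1 : forall a, \sum_b M a b = 1.
Hypothesis Mpsd : forall x : 'I_n -> R, 0 <= \sum_a \sum_b M a b * (x a * x b).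
Hypotheses (n_gt0 : (0 < n)%N) (kn : (k <= n)%N).

Let T := \sum_a M a a - 1.
Let tau := Num.sqrt (Num.min (T ^+ 2) T).
Let K := centered M.
Let nD0 : n%:R != 0 :> R. Proof. by rewrite pnatr_eq0 -lt0n. Qed.

(** The mean, over two independent uniform permutations s and t, of the product
    of the n M (s i) (t i) over the first k positions; for the channel overlap
    matrix this is one plus the divergence to be bounded. *)
Definition mean_perm_prod : R := (\sum_(s : {perm 'I_n}) \sum_(t : {perm 'I_n})
  \prod_(i < n | (i < k)%N) (n%:R * M (s i) (t i))) / (n`! ^ 2)%:R.

Let TE : T = \sum_a K a a.
Proof. by rewrite sumrB sumr_const card_ord -[_ *+ n]mulr_natr mulVf. Qed.

Lemma centered_trace_ge0 : 0 <= T.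
Proof.
rewrite TE; apply: trace_ge0.
- exact: centered_sym.
- exact: centered_row_sum.
- exact: centered_psd.
- exact: one_sub_centered_psd.
Qed.

Let A l := overlap_sum K l.

Let mean_perm_prodE : mean_perm_prod =
  \sum_(l < k.+1) ('C(k, l) * n ^ l)%:R * A l / (n`! ^ 2)%:R.
Proof.
rewrite /mean_perm_prod -mulr_suml; congr (_ / _).
under eq_bigr => s _.
  under eq_bigr => t _.
    under eq_bigr => i _.
      rewrite (_ : _ * _ = 1 + n%:R * K (s i) (t i)); last by rewrite /K /centered mulrBr divff// addrC subrK.
      over.
    over.
  over.
rewrite (prod_add1_expansion (fun a b => n%:R * K a b) kn); apply: eq_bigr => l _.
rewrite natrM natrX -[_ *+ _]mulr_natl -mulrA; congr (_ * _).
have ln : (l <= n)%N by rewrite (leq_trans _ kn)// -ltnS.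
rewrite /A /overlap_sum mulr_sumr; apply: eq_bigr => s _.
rewrite mulr_sumr; apply: eq_bigr => t _.
by rewrite big_split/= [X in X * _ = _]big_ord_narrow//= prodr_const card_ord.
Qed.

Let Kgram : is_gram K.
Proof.
apply: spectral_gram.
- exact: centered_sym.
- exact: centered_row_sum.
- exact: centered_psd.
- exact: one_sub_centered_psd.
Qed.

Let A_ge0 l : (l <= n)%N -> 0 <= A l.
Proof. exact: overlap_sum_ge0. Qed.

Let A1 : A 1 = 0.
Proof.
apply/eqP; rewrite eq_le A_ge0// andbT.
have := marked_sum_le Kgram Kgram n_gt0; rewrite -overlap_sumS subn0.
rewrite [\sum_a _]big1 => [|a _]; last exact: centered_row_sum.
rewrite expr0n/= !mulr0 !mul0r addr0 pmulr_rle0//.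
by rewrite exprn_gt0// ltr0n.
Qed.

Let q : R := 512 * tau * k%:R / n%:R.

(** The binomial coefficient and the factorials combine to the ratio of falling
    factorials k ^_ l / n ^_ l, at most (k / n) ^ l, and the ratio
    n ^ l / n ^_ l, at most 4 ^ l. *)
Let term_le l : (l <= k)%N -> ('C(k, l) * n ^ l)%:R * A l / (n`! ^ 2)%:R <= q ^+ l.
Proof.
move=> lk; have ln := leq_trans lk kn.
have tau0 : 0 <= tau by exact: sqrtr_ge0.
have Ale : A l <= ((n - l)`! ^ 2)%:R * (l`!%:R * (128 * tau) ^+ l).
  rewrite /tau TE; apply: overlap_sum_bound => //.
  - exact: centered_sym.
  - exact: centered_row_sum.
  - exact: centered_psd.
  - exact: one_sub_centered_psd.
  - exact: centered_abs_le1.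
rewrite ler_pdivrMr ?ltr0n ?expn_gt0 ?fact_gt0//.
apply: (le_trans (ler_wpM2l _ Ale)); first by [].
have h : ('C(k, l) * n ^ l * (n - l)`! ^ 2 * l`! * n ^ l <= 4 ^ l * k ^ l * n`! ^ 2)%N.
  rewrite -(ffact_fact ln).
  have h1 := ffact_ratio_le l kn; have h2 := expn_le_ffact ln.
  rewrite -(bin_ffact k l) in h1.
  have := leq_mul h1 h2; move: ('C(k, l)) (l`!) (n ^ l)%N (k ^ l)%N (n ^_ l) ((n - l)`!) (4 ^ l)%N => a b c d e f g h3.
  have := leq_mul h3 (leqnn (f ^ 2)%N); rewrite (_ : _ * _ * _ = a * c * f ^ 2 * b * c)%N; last by ring.
  by move=> /leq_trans; apply; rewrite leq_eqVlt; apply/orP; left; apply/eqP; ring.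
have t0 : 0 <= (128 * tau) ^+ l by exact: exprn_ge0 (mulr_ge0 (ler0n R 128) tau0).
have qE : q ^+ l * (n ^ l)%:R = (4 ^ l * k ^ l)%:R * (128 * tau) ^+ l.
  rewrite natrM !natrX -!exprMn; congr (_ ^+ _); rewrite /q; field.
  by rewrite pnatr_eq0 -lt0n.
have nl0 : 0 < (n ^ l)%:R :> R by rewrite ltr0n expn_gt0 n_gt0.
rewrite -(ler_pM2r nl0) mulrAC [leRHS]mulrAC qE.
rewrite -(ler_nat R) in h; have := ler_wpM2r t0 h; rewrite !natrM => h1.
apply: le_trans (le_trans h1 _); rewrite le_eqVlt; apply/orP; left; apply/eqP; ring.
Qed.

Let fact2_neq0 : (n`! ^ 2)%:R != 0 :> R.
Proof. by rewrite pnatr_eq0 -lt0n expn_gt0 fact_gt0. Qed.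

Lemma mean_perm_prod_ge1 : 1 <= mean_perm_prod.
Proof.
rewrite mean_perm_prodE big_ord_recl/= bin0 mul1n expn0 mul1r /A overlap_sum0 (divff fact2_neq0).
rewrite lerDl; apply: sumr_ge0 => l _; rewrite divr_ge0// mulr_ge0// A_ge0//.
by rewrite (leq_trans _ kn)//; exact: ltn_ord.
Qed.

(** The expansion is dominated by the geometric series of q from degree two on:
    its term of degree zero is 1, and its term of degree one vanishes since
    the rows of the centered kernel sum to zero. *)
Lemma mean_perm_prod_le : q <= 2^-1 -> mean_perm_prod - 1 <= 2 * q ^+ 2.
Proof.
move=> q1; have q0 : 0 <= q by exact: divr_ge0 (mulr_ge0 (mulr_ge0 (ler0n R 512) (sqrtr_ge0 _)) (ler0n R k)) (ler0n R n).
rewrite mean_perm_prodE big_ord_recl/= bin0 mul1n expn0 mul1r /A overlap_sum0 (divff fact2_neq0).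
rewrite addrAC subrr add0r.
case: k kn term_le q1 q0 => [|k'] kn' tle q1 q0.
  by rewrite big_ord0 mulr_ge0// sqr_ge0.
rewrite big_ord_recl/= [X in X + _](_ : _ = 0) ?add0r; last first.
  by have := A1; rewrite /A => ->; rewrite mulr0 mul0r.
apply: (@le_trans _ _ (\sum_(i < k') q ^+ 2 * q ^+ i)).
  by apply: ler_sum => i _; rewrite -exprD; apply: tle; exact: ltn_ord.
rewrite -mulr_sumr mulrC ler_wpM2r ?sqr_ge0// geometric_sum_le2//.
by rewrite q0.
Qed.

End doubly_stochastic.

Local Open Scope classical_set_scope.
Local Open Scope ring_scope.
Local Open Scope ereal_scope.

(** * Integration over product probabilities *)

Section product_integral.
Context d (T : measurableType d) (R : realType).
Implicit Types (n : nat).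

Lemma measurable_tuple_cons n : measurable_fun setT (@tuple_cons _ T n).
Proof. exact: measurable_funP. Qed.

Lemma integral_prod_probabilityS n (P : 'I_n.+1 -> probability T R)
    (f : n.+1.-tuple T -> \bar R) :
  measurable_fun [set: _.-tuple T] f -> (forall t, 0 <= f t) ->
  \int[prod_probability P]_t f t =
  \int[P ord0]_x \int[prod_probability (fun i => P (lift ord0 i))]_t
    f (tuple_cons (x, t)).
Proof.
move=> mf f0; rewrite /= ge0_integral_distribution//.
rewrite fubini_tonelli1//; last by move=> x /=.
exact: measurableT_comp mf (@measurable_tuple_cons n).
Qed.

Lemma measurable_fun_tuple_cons_integral n (Q : probability (n.-tuple T) R)
    (f : n.+1.-tuple T -> \bar R) :
  measurable_fun [set: _.-tuple T] f -> (forall t, 0 <= f t) ->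
  measurable_fun setT (fun x => \int[Q]_t f (tuple_cons (x, t))).
Proof.
move=> mf f0.
apply: (@measurable_fun_fubini_tonelli_F _ _ _ _ _ Q (f \o @tuple_cons _ T n)).
  exact: measurableT_comp mf (@measurable_tuple_cons n).
by move=> x /=.
Qed.

Lemma measurable_tuple_cons2 n (x : T) :
  measurable_fun [set: n.-tuple T] (fun t => tuple_cons (x, t)).
Proof. exact: measurableT_comp (@measurable_tuple_cons n) (measurable_pair1 x). Qed.

Lemma integral_first_coords n k (kn : (k <= n)%N) (P : 'I_n -> probability T R)
    (f : k.-tuple T -> \bar R) :
  measurable_fun [set: _.-tuple T] f -> (forall t, 0 <= f t) ->
  \int[prod_probability P]_t f (first_coords kn t) =
  \int[prod_probability (fun i => P (widen_ord kn i))]_t f t.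
Proof.
elim: k n kn P f => [|k IH] [//|n] kn P f mf f0.
- rewrite /=; congr (integral _ _ _).
  by apply/funext => t; rewrite [first_coords kn t]tuple0 [t]tuple0.
- have -> : (fun t => f (first_coords kn t)) = cst (f [tuple]).
    by apply/funext => t; rewrite (tuple0 (first_coords _ _)).
  transitivity (f [tuple]); last by rewrite /= integral_dirac// diracT mul1e.
  rewrite integral_cst// -[RHS]mule1; congr (_ * _); exact: probability_setT.
have kn' : (k <= n)%N by [].
rewrite integral_prod_probabilityS//; last first.
  exact: measurableT_comp.
rewrite integral_prod_probabilityS//.
have -> : widen_ord kn ord0 = ord0 by exact: val_inj.
apply: eq_integral => x _.
have -> : (fun i => P (widen_ord kn (lift ord0 i))) =
          (fun i => P (lift ord0 (widen_ord kn' i))).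
  by apply/funext => i; congr P; exact: val_inj.
rewrite -(IH _ kn' (fun i => P (lift ord0 i)) (fun t => f (tuple_cons (x, t))))//; last first.
  by apply: measurableT_comp => //; exact: measurable_tuple_cons2.
apply: eq_integral => t _; congr f; apply: eq_from_tnth => i.
rewrite tnth_mktuple; case: (unliftP ord0 i) => [j ->|->].
  rewrite tnthS tnth_mktuple.
  by rewrite (_ : widen_ord kn (lift ord0 j) = lift ord0 (widen_ord kn' j)) ?tnthS//; exact: val_inj.
by rewrite (_ : widen_ord kn ord0 = ord0)//; exact: val_inj.
Qed.

Lemma measurable_prod_tnth n (h : 'I_n -> T -> R) :
  (forall i, measurable_fun setT (h i)) ->
  measurable_fun [set: n.-tuple T] (fun t => (\prod_(i < n) h i (tnth t i))%R).
Proof.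
move=> mh; apply: measurable_prod => i _; apply: measurableT_comp => //.
exact: measurable_tnth.
Qed.

Lemma integral_prod_tnth n (P : 'I_n -> probability T R) (h : 'I_n -> T -> R) :
  (forall i, measurable_fun setT (h i)) -> (forall i x, (0 <= h i x)%R) ->
  \int[prod_probability P]_t (\prod_(i < n) h i (tnth t i))%:E =
  \prod_(i < n) \int[P i]_x (h i x)%:E.
Proof.
elim: n P h => [|n IH] P h mh h0.
  rewrite big_ord0; transitivity (\int[prod_probability P]_t (cst 1) t).
    by apply: eq_integral => t _; rewrite big_ord0.
  rewrite integral_cst// mul1e; exact: probability_setT.
have mH := measurable_prod_tnth mh.
rewrite integral_prod_probabilityS//=; first last.
- by move=> t; rewrite lee_fin prodr_ge0.
- exact/measurable_EFinP.
rewrite big_ord_recl -(IH (fun i => P (lift ord0 i)) (fun i => h (lift ord0 i)))//.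
rewrite -ge0_integralZr//; first last.
- by apply: integral_ge0 => t _; rewrite lee_fin prodr_ge0.
- by move=> x _; rewrite lee_fin.
- exact/measurable_EFinP.
apply: eq_integral => x _; rewrite -ge0_integralZl//; first last.
- by rewrite lee_fin.
- by move=> t _; rewrite lee_fin prodr_ge0.
- by apply/measurable_EFinP; apply: (@measurable_prod_tnth _ (fun i => h (lift ord0 i))).
apply: eq_integral => t _; rewrite big_ord_recl -EFinM; congr (_ * _)%:E.
by apply: eq_bigr => i _; rewrite tnthS.
Qed.

Lemma integral_prod_density n (P Q : 'I_n -> probability T R) (q : 'I_n -> T -> R)
    (f : n.-tuple T -> \bar R) :
  (forall i, measurable_fun setT (q i)) -> (forall i x, (0 <= q i x)%R) ->
  (forall i g, measurable_fun setT g -> (forall x, 0 <= g x) ->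
     \int[P i]_x g x = \int[Q i]_x (g x * (q i x)%:E)) ->
  measurable_fun [set: _.-tuple T] f -> (forall t, 0 <= f t) ->
  \int[prod_probability P]_t f t =
  \int[prod_probability Q]_t (f t * (\prod_(i < n) q i (tnth t i))%:E).
Proof.
elim: n P Q q f => [|n IH] P Q q f mq q0 PQ mf f0.
  by apply: eq_integral => t _; rewrite big_ord0 mule1.
have mH := measurable_prod_tnth mq.
rewrite integral_prod_probabilityS//= PQ//; first last.
- by move=> x; apply: integral_ge0.
- exact: measurable_fun_tuple_cons_integral.
rewrite [RHS]integral_prod_probabilityS//=; first last.
- by move=> t; rewrite mule_ge0// lee_fin prodr_ge0.
- by apply: emeasurable_funM => //; exact/measurable_EFinP.
apply: eq_integral => x _.
have mfx : measurable_fun [set: n.-tuple T] (fun t => f (tuple_cons (x, t))).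
  by apply: measurableT_comp => //; exact: measurable_tuple_cons2.
have mH' := @measurable_prod_tnth _ (fun i => q (lift ord0 i)) (fun i => mq (lift ord0 i)).
rewrite (IH _ (fun i => Q (lift ord0 i)) (fun i => q (lift ord0 i)))//.
rewrite -ge0_integralZr//; first last.
- by rewrite lee_fin.
- by move=> t _; rewrite mule_ge0// lee_fin prodr_ge0.
- by apply: emeasurable_funM => //; exact/measurable_EFinP.
apply: eq_integral => t _; rewrite big_ord_recl -muleA -EFinM; congr (_ * _%:E).
by rewrite mulrC; congr (_ * _)%R; apply: eq_bigr => i _; rewrite tnthS.
by move=> i g mg g0; exact: PQ.
Qed.

End product_integral.

(** * Densities with respect to the mean *)

Section densities.
Context d (X : measurableType d) (R : realType).
Variables (n : nat) (n_gt0 : (0 < n)%N) (P : 'I_n -> probability X R).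
Local Notation Q := (mean_probability n_gt0 P).

Let nD0 : n%:R != 0%R :> R. Proof. by rewrite pnatr_eq0 -lt0n. Qed.

Lemma sum_mean_probability A : \sum_(i < n) P i A = n%:R%:E * Q A.
Proof.
rewrite /mean_probability /= /unif_mixture card_ord muleA -EFinM.
by rewrite divff// mul1e.
Qed.

Lemma mean_probability_dominates i : P i `<< Q.
Proof.
apply/null_content_dominatesP => A mA QA0.
have : \sum_(i < n) P i A = 0 by rewrite sum_mean_probability QA0 mule0.
move=> /eqP; rewrite (bigD1 i)//= padde_eq0 ?sume_ge0// => /andP[/eqP].
by [].
Qed.

(** Almost everywhere the densities are nonnegative with sum n.  Redefining all
    of them as 1 on the exceptional null set makes these relations hold
    everywhere; each density then lies between 0 and n, so that all integrals
    below are finite. *)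
Lemma bounded_densities : exists q : 'I_n -> X -> R,
  [/\ forall i, measurable_fun setT (q i),
      forall i x, (0 <= q i x)%R,
      forall x, (\sum_i q i x)%R = n%:R,
      forall i, ae_eq Q setT (density (P i) Q) (EFin \o q i) &
      forall i g, measurable_fun setT g -> (forall x, 0 <= g x) ->
        \int[P i]_x g x = \int[Q]_x (g x * (q i x)%:E)].
Proof.
pose g i := Radon_Nikodym_SigmaFinite.f (P i) Q.
have dom := mean_probability_dominates.
have g0 i x : 0 <= g i x by exact: (Radon_Nikodym_SigmaFinite.f_ge0 (dom i)).
have gfin i x : g i x \is a fin_num by exact: (Radon_Nikodym_SigmaFinite.f_fin_num (dom i)).
have gint i : Q.-integrable [set: X] (g i) by exact: (Radon_Nikodym_SigmaFinite.f_integrable (dom i)).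
have mg i : measurable_fun setT (g i) by exact: measurable_int (gint i).
pose h i x := fine (g i x).
have hE i x : g i x = (h i x)%:E by rewrite fineK.
have mh i : measurable_fun setT (h i).
  by apply: measurableT_comp => //; exact: mg.
have sumE : ae_eq Q setT (fun x => \sum_i g i x) (cst (n%:R%:E)).
  apply: integral_ae_eq => //.
  - by apply: integrable_sum.
  - move=> A _ mA; rewrite ge0_integral_sum//; last first.
      by move=> i; exact: measurable_funTS.
    rewrite integral_cst// -sum_mean_probability; apply: eq_bigr => i _.
    by rewrite -Radon_Nikodym_SigmaFinite.f_integral//; exact: dom.
pose E := [set x | (\sum_i h i x)%R = n%:R].
have mE : measurable E.
  have : measurable_fun setT (fun x => (\sum_i h i x)%R) by exact: measurable_sum.
  by move=> /(_ measurableT [set n%:R]); rewrite setTI; apply.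
pose q i x := if x \in E then h i x else 1%R.
have qg i : ae_eq Q setT (g i) (EFin \o q i).
  case: sumE => N [mN N0 sub]; exists N; split => // x/= gq; apply: sub => /= e.
  apply: gq => _; rewrite hE /q mem_set//.
  apply: EFin_inj; rewrite -sumEFin -e//.
  by apply: eq_bigr => j _; rewrite hE.
have mq i : measurable_fun setT (q i).
  apply: measurable_fun_ifT => //.
  by apply: (measurable_fun_bool true); rewrite setTI preimage_mem_true.
exists q; split => //.
- by move=> i x; rewrite /q; case: ifPn => // _; rewrite fine_ge0.
- move=> x; rewrite /q; case: (boolP (x \in E)) => [/set_mem//|_].
  by rewrite sumr_const card_ord.
- move=> i; apply: ae_eq_trans (qg i); apply: ae_eq_sym.
  exact: (ae_eq_Radon_Nikodym_SigmaFinite (dom i) measurableT).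
- move=> i f mf f0.
  rewrite -(Radon_Nikodym_SigmaFinite.change_of_variables (dom i))//.
  apply: ae_eq_integral => //.
  + by apply: emeasurable_funM => //; exact: (mg i).
  + by apply: emeasurable_funM => //; exact/measurable_EFinP.
  + case: (qg i) => N [mN N0 sub]; exists N; split => // x/= ne; apply: sub => /= e.
    by apply: ne => _; rewrite -/(g i) e.
Qed.

End densities.

Local Close Scope ereal_scope.

(** * The channel overlap matrix is doubly stochastic and positive *)

Section overlap.
Context d (X : measurableType d) (R : realType).
Variables (n : nat) (n_gt0 : (0 < n)%N) (P : 'I_n -> probability X R).
Local Notation Q := (mean_probability n_gt0 P).
Local Notation M := (channel_overlap n_gt0 P).
Variable q : 'I_n -> X -> R.
Hypothesis mq : forall i, measurable_fun setT (q i).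
Hypothesis q0 : forall i x, 0 <= q i x.
Hypothesis qn : forall x, \sum_i q i x = n%:R.
Hypothesis qP : forall i, ae_eq Q setT (density (P i) Q) (EFin \o q i).
Hypothesis PQ : forall i g, measurable_fun setT g -> (forall x, 0 <= g x)%E ->
  (\int[P i]_x g x = \int[Q]_x (g x * (q i x)%:E))%E.

Let nD0 : n%:R != 0 :> R. Proof. by rewrite pnatr_eq0 -lt0n. Qed.

Let q_le i x : q i x <= n%:R.
Proof. by rewrite -(qn x) (bigD1 i)//= lerDl sumr_ge0. Qed.

Let integrable_qq i j : Q.-integrable setT (fun x => (q i x * q j x)%:E).
Proof.
apply: (@measurable_bounded_integrable _ _ _ Q (fun x => q i x * q j x)) => //.
- by rewrite ltey_eq fin_num_measure.
- exact: measurable_funM.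
exists (n%:R * n%:R); split; first exact: num_real.
move=> y ny x _ /=; rewrite ger0_norm ?mulr_ge0//.
by rewrite (le_trans _ (ltW ny))// ler_pM.
Qed.

Lemma channel_overlapE i j : (\int[Q]_x (q i x * q j x)%:E = (n%:R * M i j)%:E)%E.
Proof.
have e : (\int[Q]_x (q i x * q j x)%:E =
    \int[Q]_x (density (P i) Q x * density (P j) Q x))%E.
  apply: ae_eq_integral => //.
  - by apply/measurable_EFinP; exact: measurable_funM.
  - by apply: emeasurable_funM; apply: measurable_int; apply: Radon_Nikodym_integrable;
      exact: mean_probability_dominates.
  - have := qP i; have := qP j; apply: filterS2 => x /= hj hi _.
    by rewrite hi// hj.
rewrite mxE mulrA divff// mul1r -e fineK//.
exact: integrable_fin_num.
Qed.

Lemma channel_overlap_sym i j : M i j = M j i.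
Proof.
by rewrite !mxE; congr (_ * fine _); apply: eq_integral => x _; rewrite muleC.
Qed.

Lemma channel_overlap_ge0 i j : 0 <= M i j.
Proof.
rewrite -(@pmulr_rge0 _ n%:R) ?ltr0n// -lee_fin -channel_overlapE.
by apply: integral_ge0 => x _; rewrite lee_fin mulr_ge0.
Qed.

Lemma channel_overlap_row_sum i : \sum_j M i j = 1.
Proof.
apply: (mulfI nD0); rewrite mulr1 mulr_sumr.
apply: EFin_inj; rewrite -sumEFin.
under eq_bigr do rewrite -channel_overlapE.
rewrite -integral_sum//.
under eq_integral do rewrite sumEFin -mulr_sumr qn EFinM muleC.
rewrite ge0_integralZl//; last 2 first.
- exact/measurable_EFinP.
- by move=> x _; rewrite lee_fin.
rewrite -[RHS]mule1; congr (_ * _)%E.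
transitivity (\int[P i]_x (cst 1 x))%E.
  by rewrite PQ//; apply: eq_integral => x _; rewrite mul1e.
rewrite integral_cst// mul1e; exact: probability_setT.
Qed.

(** The form at x is an integral of the square of a combination of the
    densities. *)
Lemma channel_overlap_psd (x : 'I_n -> R) : 0 <= \sum_a \sum_b M a b * (x a * x b).
Proof.
rewrite -(@pmulr_rge0 _ n%:R) ?ltr0n// -lee_fin.
have -> : (n%:R * \sum_a \sum_b M a b * (x a * x b))%:E =
   (\int[Q]_t (((\sum_a x a * q a t) ^+ 2)%R)%:E)%E.
  rewrite (eq_integral (fun t => \sum_a \sum_b (((x a * x b)%R)%:E * ((q a t * q b t)%R)%:E))%E); last first.
    move=> t _; rewrite expr2 big_distrlr/= -sumEFin; apply: eq_bigr => a _.
    by rewrite -sumEFin; apply: eq_bigr => b _; rewrite -EFinM; congr EFin; rewrite mulrACA.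
  rewrite integral_sum//; last first.
    by move=> a; apply: integrable_sum => // b _; exact: integrableZl.
  rewrite mulr_sumr -sumEFin; apply: eq_bigr => a _.
  rewrite integral_sum//; last by move=> b; exact: integrableZl.
  rewrite mulr_sumr -sumEFin; apply: eq_bigr => b _.
  rewrite integralZl// channel_overlapE -EFinM; congr EFin.
  by ring.
by apply: integral_ge0 => t _; rewrite lee_fin sqr_ge0.
Qed.

End overlap.

(** * The divergence between the marginals *)

Section chi2_density.
Context d (T : measurableType d) (R : realType).

Lemma chi2_of_density (P Q : probability T R) (f : T -> R) :
  measurable_fun setT f -> (forall x, 0 <= f x) ->
  (forall A, measurable A -> P A = \int[Q]_(x in A) (f x)%:E)%E ->
  chi2 P Q = (\int[Q]_x ((f x) ^+ 2)%:E - 1)%E.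
Proof.
move=> mf f0 Pf.
have mEf : measurable_fun setT (EFin \o f) by exact/measurable_EFinP.
have PQ : P `<< Q.
  apply/null_content_dominatesP => A mA QA0; rewrite Pf//.
  by apply: null_set_integral => //; exact: measurable_funTS.
rewrite /chi2; case: ifPn => [_|/asboolPn//]; congr (_ - _)%E.
have dint : Q.-integrable setT (density P Q).
  exact: Radon_Nikodym_integrable.
have df : ae_eq Q setT (density P Q) (EFin \o f).
  apply: integral_ae_eq => // A _ mA.
  by rewrite -[RHS]Pf// /density -Radon_Nikodym_integral.
have md : measurable_fun setT (density P Q) by exact: measurable_int dint.
apply: ae_eq_integral => //.
- by apply: emeasurable_funM.
- by apply/measurable_EFinP; exact: measurable_funM.
- by apply: filterS df => x /= h _; rewrite h//.
Qed.

End chi2_density.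

Section marginals.
Context d (X : measurableType d) (R : realType).
Variables (n : nat) (n_gt0 : (0 < n)%N) (P : 'I_n -> probability X R).
Variables (k : nat) (kn : (k <= n)%N).
Local Notation Q := (mean_probability n_gt0 P).
Local Notation M := (channel_overlap n_gt0 P).
Variable q : 'I_n -> X -> R.
Hypothesis mq : forall i, measurable_fun setT (q i).
Hypothesis q0 : forall i x, 0 <= q i x.
Hypothesis qn : forall x, \sum_i q i x = n%:R.
Hypothesis qP : forall i, ae_eq Q setT (density (P i) Q) (EFin \o q i).
Hypothesis PQ : forall i g, measurable_fun setT g -> (forall x, 0 <= g x)%E ->
  (\int[P i]_x g x = \int[Q]_x (g x * (q i x)%:E))%E.

Let Qk : probability (k.-tuple X) R := prod_probability (fun=> Q).
Let Q' := marginal kn (iid_mean n_gt0 P).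
Let P' := marginal kn (permutation_mixture P).

Let integral_marginal (g : k.-tuple X -> \bar R) :
  measurable_fun [set: k.-tuple X] g -> (forall t, 0 <= g t)%E ->
  (\int[Q']_t g t = \int[Qk]_t g t)%E.
Proof.
move=> mg g0; rewrite /Q' /marginal ge0_integral_distribution//.
exact: integral_first_coords.
Qed.

Let w (s : {perm 'I_n}) (t : k.-tuple X) : R :=
  \prod_(i < k) q (s (widen_ord kn i)) (tnth t i).

Let w0 s t : 0 <= w s t.
Proof. exact: prodr_ge0. Qed.

Let mw s : measurable_fun [set: k.-tuple X] (w s).
Proof. by apply: (@measurable_prod_tnth _ _ _ _ (fun i => q (s (widen_ord kn i)))). Qed.

Let f (t : k.-tuple X) : R := n`!%:R^-1 * \sum_s w s t.

Let f0 t : 0 <= f t.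
Proof. by rewrite mulr_ge0 ?invr_ge0// sumr_ge0. Qed.

Let mf : measurable_fun [set: k.-tuple X] f.
Proof. by apply: measurable_funM => //; exact: measurable_sum. Qed.

Let marginal_density (A : set (k.-tuple X)) : measurable A ->
  (P' A = \int[Q']_(t in A) (f t)%:E)%E.
Proof.
move=> mA.
rewrite integral_mkcond epatch_indic/= integral_marginal; first last.
- by move=> t; rewrite mule_ge0// lee_fin.
- by apply: emeasurable_funM; apply/measurable_EFinP => //.
transitivity (((n`!%:R^-1 : R)%R)%:E * \sum_(s : {perm 'I_n}) \int[Qk]_t ((\1_A t)%:E * (w s t)%:E))%E.
  rewrite /P' /marginal /distribution /pushforward /= /unif_mixture card_Sn; congr (_ * _)%E.
  apply: eq_bigr => s _.
  have m1A : measurable_fun [set: k.-tuple X] (fun t => (\1_A t)%:E : \bar R).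
    exact/measurable_EFinP.
  have A0 (t : k.-tuple X) : (0 <= (\1_A t)%:E :> \bar R)%E by rewrite lee_fin.
  rewrite -(@integral_prod_density _ _ _ _ (fun i => P (s (widen_ord kn i))) (fun=> Q)
    (fun i => q (s (widen_ord kn i))) _ (fun i => mq _) (fun i x => q0 _ x)
    (fun i => @PQ _) m1A A0).
  rewrite -(@integral_first_coords _ _ _ n k kn (fun i => P (s i)) _ m1A A0).
  have mB : measurable (first_coords kn @^-1` A).
    by rewrite -[X in measurable X]setTI; exact: measurable_funP.
  rewrite -[X in _ X = _]setIT -integral_indic//.
rewrite -ge0_integral_sum//; first last.
- by move=> s t _; rewrite mule_ge0// lee_fin.
- by move=> s; apply: emeasurable_funM; apply/measurable_EFinP => //.
rewrite -ge0_integralZl//; first last.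
- by move=> t _; apply: sume_ge0 => s _; rewrite mule_ge0// lee_fin.
- by apply: emeasurable_sum => s; apply: emeasurable_funM; apply/measurable_EFinP => //.
apply: eq_integral => t _.
rewrite -ge0_sume_distrr//; last by move=> s _; rewrite lee_fin.
by rewrite sumEFin -!EFinM /f; congr EFin; ring.
Qed.

(** The marginal of the permutation mixture has as density the mean over s of
    the products of the q (s i).  In its square two independent permutations
    appear, and by Fubini's theorem the integral of each product factors into
    the integrals of q (s i) q (t i), equal to n M (s i) (t i). *)
Lemma chi2_marginal_with_density :
  chi2 P' Q' = (mean_perm_prod k (fun a b => M a b) - 1)%:E.
Proof.
rewrite (chi2_of_density mf f0 marginal_density) EFinB; congr (_ - _)%E.
rewrite integral_marginal; first last.
- by move=> t; rewrite lee_fin sqr_ge0.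
- by apply/measurable_EFinP; exact: measurable_funM.
pose g (s t : {perm 'I_n}) (i : 'I_k) x :=
  q (s (widen_ord kn i)) x * q (t (widen_ord kn i)) x.
have g0 s t i x : 0 <= g s t i x by exact: mulr_ge0.
have mg s t i : measurable_fun setT (g s t i) by exact: measurable_funM.
have wwE s t y : w s y * w t y = \prod_(i < k) g s t i (tnth y i) by rewrite -big_split.
transitivity (\int[Qk]_y (((n`!%:R ^- 2 : R)%R)%:E * \sum_(s : {perm 'I_n}) \sum_(t : {perm 'I_n})
   (w s y * w t y)%R%:E))%E.
  apply: eq_integral => y _.
  under eq_bigr do rewrite sumEFin.
  by rewrite sumEFin -EFinM /f exprMn exprVn expr2 [in LHS]expr2 big_distrlr.
have mww s t : measurable_fun [set: k.-tuple X] (fun y => (w s y * w t y)%:E).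
  by apply/measurable_EFinP; exact: measurable_funM.
rewrite ge0_integralZl//; last 2 first.
- by apply: emeasurable_sum => s; exact: emeasurable_sum.
- by move=> y _; do 2 apply: sume_ge0 => ? _; rewrite lee_fin mulr_ge0.
rewrite ge0_integral_sum//; last 2 first.
- by move=> s; exact: emeasurable_sum.
- by move=> s y _; apply: sume_ge0 => ? _; rewrite lee_fin mulr_ge0.
rewrite /mean_perm_prod mulrC EFinM natrX; congr (_ * _)%E.
rewrite -sumEFin; apply: eq_bigr => s _.
rewrite ge0_integral_sum//; last by move=> t y _; rewrite lee_fin mulr_ge0.
rewrite -sumEFin; apply: eq_bigr => t _.
under eq_integral do rewrite wwE.
rewrite integral_prod_tnth// big_ord_narrow -prodEFin.
by apply: eq_bigr => i _; exact: channel_overlapE.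
Qed.

End marginals.

(** * The eigenvalues of the overlap matrix *)

Section eigenvalues.
Variables (R : realType) (n : nat) (M : 'M[R]_n) (lam : seq R).
Hypothesis M_ge0 : forall i j, 0 <= M i j.
Hypothesis Mcol : forall j, \sum_i M i j = 1.
Hypothesis Mrow : forall i, \sum_j M i j = 1.
Hypothesis n_gt0 : (0 < n)%N.
Hypothesis lamM : eigenvalues_of M lam.

Let mem_lam x : (x \in lam) = eigenvalue M x.
Proof. by rewrite eigenvalue_root_char lamM.2 root_prod_XsubC. Qed.

Let size_lam : size lam = n.
Proof.
by have := size_char_poly M; rewrite lamM.2 size_prod_XsubC => -[].
Qed.

(** Row vectors are contracted in the l^1 norm by a nonnegative matrix with row
    sums 1. *)
Lemma stochastic_eigenvalue_le1 x : x \in lam -> x <= 1.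
Proof.
rewrite mem_lam => /eigenvalueP[v /rowP vM v0].
have [j vj0] : exists j, v 0 j != 0.
  by apply/existsP; apply: contraNT v0; rewrite negb_exists => /forallP h;
     apply/eqP/rowP => j; rewrite mxE; apply/eqP; rewrite -[_ == _]negbK h.
have S_gt0 : 0 < \sum_j `|v 0 j|.
  by rewrite (bigD1 j)//= ltr_wpDr ?sumr_ge0// normr_gt0.
apply: (le_trans (ler_norm x)); rewrite -(ler_pM2r S_gt0) mul1r mulr_sumr.
apply: (@le_trans _ _ (\sum_j \sum_i `|v 0 i| * M i j)).
  apply: ler_sum => l _; have := vM l; rewrite !mxE -normrM => <-.
  apply: (le_trans (ler_norm_sum _ _ _)); apply: ler_sum => i _.
  by rewrite normrM (ger0_norm (M_ge0 _ _)).
rewrite exchange_big/=; apply: ler_sum => i _.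
by rewrite -mulr_sumr Mrow mulr1.
Qed.

(** The constant row vector is an eigenvector for 1 as the column sums are 1. *)
Lemma stochastic_top_eigenvalue : lam`_0 = 1.
Proof.
have lam1 : 1 \in lam.
  rewrite mem_lam; apply/eigenvalueP; exists (const_mx 1).
    by apply/rowP => j; rewrite !mxE; under eq_bigr do rewrite mxE mul1r; rewrite Mcol mulr1.
  by apply/eqP => /rowP/(_ (Ordinal n_gt0)); rewrite !mxE => /eqP; rewrite oner_eq0.
have := stochastic_eigenvalue_le1; case: lamM => + _; case: (lam) lam1 => [//|x s] x1 /= srt le1.
apply/eqP; rewrite eq_le le1 ?mem_head//=.
move: x1; rewrite inE => /orP[/eqP->//|s1].
by have /allP/(_ _ s1) := order_path_min (rev_trans le_trans) srt.
Qed.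

Lemma sum_nontop_eigenvalues : \sum_(1 <= i < n) lam`_i = \sum_i M i i - 1.
Proof.
have trE : \sum_(x <- lam) x = \tr M.
  have := char_poly_trace M n_gt0; rewrite lamM.2 (_ : n.-1 = (size lam).-1); last by rewrite size_lam.
  rewrite coefPn_prod_XsubC ?size_lam -?lt0n//.
  by move/oppr_inj.
rewrite -/(\tr M) -trE [X in _ = X - _](big_nth 0) size_lam big_ltn// stochastic_top_eigenvalue.
by rewrite addrAC subrr add0r.
Qed.

End eigenvalues.

(** * The divergence in terms of the eigenvalues *)

Section chi2_marginal.
Variables (R : realType) (d : measure_display) (X : measurableType d).
Variables (n : nat) (n_gt0 : (0 < n)%N) (P : 'I_n -> probability X R) (lam : seq R).
Hypothesis lamP : eigenvalues_of (channel_overlap n_gt0 P) lam.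
Variables (k : nat) (kn : (k <= n)%N).
Let T := \sum_(1 <= i < n) lam`_i.
Let tau := Num.sqrt (Num.min (T ^+ 2) T).

Lemma chi2_marginal_bounds : exists e : R,
  [/\ chi2 (marginal kn (permutation_mixture P)) (marginal kn (iid_mean n_gt0 P)) = e%:E,
      0 <= T, 0 <= e &
      512 * tau * k%:R / n%:R <= 2^-1 -> e <= 2 * (512 * tau * k%:R / n%:R) ^+ 2].
Proof.
have [q [mq q0 qn qP PQ]] := bounded_densities n_gt0 P.
pose M := channel_overlap n_gt0 P.
have Msym := channel_overlap_sym n_gt0 P.
have M0 : forall i j, 0 <= M i j := channel_overlap_ge0 mq q0 qn qP.
have M1 : forall i, \sum_j M i j = 1 := channel_overlap_row_sum mq q0 qn qP PQ.
have Mpsd := channel_overlap_psd mq q0 qn qP.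
have TE : T = \sum_i M i i - 1.
  apply: sum_nontop_eigenvalues => // j.
  by rewrite -[RHS](M1 j); apply: eq_bigr => i _; exact: Msym.
exists (mean_perm_prod k (fun a b => M a b) - 1); split.
- exact: chi2_marginal_with_density mq q0 qn qP PQ.
- by rewrite TE; apply: centered_trace_ge0.
- by rewrite subr_ge0; apply: mean_perm_prod_ge1.
- by rewrite /tau TE => h; apply: mean_perm_prod_le.
Qed.

End chi2_marginal.

Unset Implicit Arguments.

Theorem corollary1p5 (R : realType) :
  (exists C : R, 0 < C /\
    forall (d : measure_display) (X : measurableType d)
      (n : nat) (n_gt0 : (0 < n)%N) (P : 'I_n -> probability X R)
      (lam : seq R),
    eigenvalues_of (channel_overlap n_gt0 P) lam ->
    let T := \sum_(1 <= i < n) lam`_i in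
    forall (k : nat) (k_gt0 : (0 < k)%N) (k_le_n : (k <= n)%N),
    (T = 0 \/ k%:R <= n%:R / (C * Num.sqrt (Num.min (T ^+ 2) T))) ->
    (chi2 (marginal k_le_n (permutation_mixture P))
          (marginal k_le_n (iid_mean n_gt0 P))
       <= (C * k%:R ^+ 2 / n%:R ^+ 2 * Num.min (T ^+ 2) T)%:E)%E)
  /\
  (forall (d : nat -> measure_display) (X : forall m, measurableType (d m))
      (n k : nat -> nat) (n_gt0 : forall m, (0 < n m)%N)
      (k_gt0 : forall m, (0 < k m)%N) (k_le_n : forall m, (k m <= n m)%N)
      (P : forall m, 'I_(n m) -> probability (X m) R)
      (lam : nat -> seq R),
    (forall m, eigenvalues_of (channel_overlap (n_gt0 m) (P m)) (lam m)) ->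
    let T := fun m => \sum_(1 <= i < n m) (lam m)`_i in
    (fun m => (k m)%:R * Num.sqrt (T m) / (n m)%:R) @ \oo --> (0 : R) ->
    (fun m => chi2 (marginal (k_le_n m) (permutation_mixture (P m)))
                   (marginal (k_le_n m) (iid_mean (n_gt0 m) (P m))))
      @ \oo --> (0 : \bar R)).
Proof.
(* D is the constant in the ratio of the geometric series; with C = 2 D ^ 2 the
   hypothesis on k makes this ratio at most 1 / (2 D), and twice its square is
   the announced bound. *)
have [D [D1 DE]] : exists D : R, 1 <= D /\ D = 512 by exists 512; rewrite ler1n.
have D0 : 0 < D by exact: lt_le_trans D1.
pose C : R := 2 * D ^+ 2.
have C0 : 0 < C by rewrite mulr_gt0// exprn_gt0.
split.
  exists C; split=> // d X n n_gt0 P lam lamP T k k_gt0 kn hk.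
  have [e [-> T0 _]] := chi2_marginal_bounds lamP kn; rewrite -DE => He.
  rewrite -/T in T0 He; set tau := Num.sqrt _ in hk He.
  have n0 : 0 < n%:R :> R by rewrite ltr0n.
  have tau0 : 0 <= tau by exact: sqrtr_ge0.
  have tau2 : tau ^+ 2 = Num.min (T ^+ 2) T by rewrite sqr_sqrtr// le_min sqr_ge0 T0.
  rewrite lee_fin -tau2.
  suff /He /le_trans : D * tau * k%:R / n%:R <= 2^-1.
    apply; rewrite le_eqVlt; apply/orP; left; apply/eqP.
    by rewrite /C; field; rewrite gt_eqF.
  have {}hk : C * tau * k%:R <= n%:R.
    have [t0|t0] := eqVneq tau 0; first by rewrite t0 mulr0 mul0r ltW.
    case: hk => [T0'|]; first by move: t0; rewrite /tau T0' expr0n/= minxx sqrtr0 eqxx.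
    by rewrite ler_pdivlMr 1?mulrC// mulr_gt0// lt_neqAle eq_sym t0.
  rewrite ler_pdivrMr//.
  have y0 : 0 <= tau * k%:R by rewrite mulr_ge0.
  have : D * (tau * k%:R) <= D ^+ 2 * (tau * k%:R).
    by rewrite ler_wpM2r// expr2 ler_peMl// ltW.
  move: hk; rewrite /C -!mulrA; lra.
move=> d X n k n_gt0 k_gt0 kn P lam lamP T x0.
have [e He] := choice (fun m => chi2_marginal_bounds (lamP m) (kn m)).
rewrite (_ : (fun m => chi2 _ _) = EFin \o e); last first.
  by apply/funext => m; have [-> _ _ _] := He m.
apply: cvg_EFin; first by apply: nearW.
pose x m := (k m)%:R * Num.sqrt (T m) / (n m)%:R.
have Cx2 : (fun m => C * x m ^+ 2) @ \oo --> (0 : R).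
  have : (fun m => C * x m ^+ 2) @ \oo --> C * (0 * 0).
    by apply: cvgM; [exact: cvg_cst|exact: cvgM].
  by rewrite !mulr0.
apply: (squeeze_cvgr _ (cvg_cst (0 : R)) Cx2).
have : \forall m \near \oo, x m < C^-1.
  by apply: (cvgr_lt _ x0); rewrite invr_gt0.
apply: filterS => m xm; have [_ T0 e0] := He m; rewrite -DE => He'; rewrite e0/=.
have x_ge0 : 0 <= x m by rewrite /x divr_ge0// mulr_ge0// sqrtr_ge0.
(* The minimum is at most T, so that tau k / n <= x m, which tends to zero. *)
set tau := Num.sqrt (Num.min _ _) in He'.
have tau_ge0 : 0 <= tau by exact: sqrtr_ge0.
have tau_le : tau <= Num.sqrt (T m) by rewrite ler_wsqrtr// ge_min lexx orbT.
set q := D * tau * (k m)%:R / (n m)%:R in He'.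
have D0' := ltW D0.
have q0 : 0 <= q by rewrite /q divr_ge0// !mulr_ge0.
have qx : q <= D * x m.
  have -> : q = D * ((k m)%:R * tau / (n m)%:R) by rewrite /q; ring.
  by rewrite ler_wpM2l// ler_wpM2r ?invr_ge0// ler_wpM2l.
have q1 : q <= 2^-1.
  apply: (le_trans qx); move: (ltW xm); rewrite -[C^-1]mul1r ler_pdivlMr// /C => h.
  have : D * x m <= D ^+ 2 * x m by rewrite ler_wpM2r// expr2 ler_peMl.
  lra.
apply: (le_trans (He' q1)); rewrite /C -mulrA ler_wpM2l// -exprMn.
by rewrite lerXn2r// nnegrE// mulr_ge0.
Qed.
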